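(* Let $\mathbb{F}$ be a field. Suppose the $\mu$-conjecture holds over $\mathbb{F}$, i.e. for every nonnegative integer $d$ and every pair of sequences $\{\theta_i\}_{i=0}^d$, $\{\theta^*_i\}_{i=0}^d$ of scalars in $\mathbb{F}$ satisfying (C1) and (C3), the associated homomorphism $\mu:\mathbb{F}[x_1,\dots,x_d]\to e^*_0Te^*_0$ is an isomorphism. Then the following holds: for every nonnegative integer $d$ and every sequence $(\{\theta_i\}_{i=0}^d;\{\theta^*_i\}_{i=0}^d;\{\zeta_i\}_{i=0}^d)$ of scalars in $\mathbb{F}$, there exists a sharp tridiagonal system over $\mathbb{F}$ with parameter array $(\{\theta_i\}_{i=0}^d;\{\theta^*_i\}_{i=0}^d;\{\zeta_i\}_{i=0}^d)$ if and only if (C1), (C2), (C3) hold; and if (C1)–(C3) hold, this tridiagonal system is unique up to isomorphism of tridiagonal systems.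
   Context: Tridiagonal pairs: let $V$ be a vector space over $\mathbb{F}$ of finite positive dimension. A tridiagonal pair on $V$ is an ordered pair of linear maps $A,A^*:V\to V$ such that (1) each of $A,A^*$ is diagonalizable; (2) there is an ordering $V_0,\dots,V_d$ of the eigenspaces of $A$ with $A^*V_i\subseteq V_{i-1}+V_i+V_{i+1}$ for $0\le i\le d$ (where $V_{-1}=V_{d+1}=0$); (3) there is an ordering $V^*_0,\dots,V^*_\delta$ of the eigenspaces of $A^*$ with $AV^*_i\subseteq V^*_{i-1}+V^*_i+V^*_{i+1}$ for $0\le i\le\delta$ (where $V^*_{-1}=V^*_{\delta+1}=0$); (4) there is no subspace $W\ne 0,V$ with $AW\subseteq W$ and $A^*W\subseteq W$. (Necessarily $d=\delta$.) Orderings as in (2),(3) are called standard. A tridiagonal system on $V$ is a sequence $\Phi=(A;\{E_i\}_{i=0}^d;A^*;\{E^*_i\}_{i=0}^d)$ where $A,A^*$ is a tridiagonal pair on $V$, $E_i$ is the primitive idempotent of $A$ for $V_i$ (the projection onto $V_i$ along the sum of the other eigenspaces) for a standard ordering $\{V_i\}$, and similarly $E^*_i$ for $A^*$ and a standard ordering $\{V^*_i\}$. Its eigenvalue sequence is $\{\theta_i\}_{i=0}^d$ where $\theta_i$ is the eigenvalue of $A$ on $E_iV$; its dual eigenvalue sequence $\{\theta^*_i\}$ is defined likewise for $A^*$. $\Phi$ is sharp if $\dim E_0V=1$ (equivalently $\dim E^*_0V=1$). For $\lambda$ an indeterminate put $\tau_i=\prod_{j=0}^{i-1}(\lambda-\theta_j)$,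 $\eta_i=\prod_{j=0}^{i-1}(\lambda-\theta_{d-j})$, $\tau^*_i=\prod_{j=0}^{i-1}(\lambda-\theta^*_j)$, $\eta^*_i=\prod_{j=0}^{i-1}(\lambda-\theta^*_{d-j})$. If $\Phi$ is sharp, for each $0\le i\le d$ there is a unique $\zeta_i\in\mathbb{F}$ with $E^*_0\tau_i(A)E^*_0=\zeta_iE^*_0/((\theta^*_0-\theta^*_1)\cdots(\theta^*_0-\theta^*_i))$; $\{\zeta_i\}$ is the split sequence and $(\{\theta_i\};\{\theta^*_i\};\{\zeta_i\})$ the parameter array of $\Phi$. Tridiagonal systems $\Phi$ on $V$ and $\Phi'=(A';\{E'_i\};A'^*;\{E'^*_i\})$ on $V'$ are isomorphic if there is a linear bijection $\sigma:V\to V'$ with $\sigma A=A'\sigma$, $\sigma A^*=A'^*\sigma$, $\sigma E_i=E'_i\sigma$, $\sigma E^*_i=E'^*_i\sigma$ for all $i$. Conditions: (C1) $\theta_i\ne\theta_j$ and $\theta^*_i\ne\theta^*_j$ for $i\ne j$; (C2) $\zeta_0=1$, $\zeta_d\neq0$, and $\sum_{i=0}^d\eta_{d-i}(\theta_0)\eta^*_{d-i}(\theta^*_0)\zeta_i\ne0$; (C3) the expressions $\frac{\theta_{i-2}-\theta_{i+1}}{\theta_{i-1}-\theta_i}$ and $\frac{\theta^*_{i-2}-\theta^*_{i+1}}{\theta^*_{i-1}-\theta^*_i}$ are equal and independent of $i$ for $2\le i\le d-1$. The algebra $T$ (for $\theta,\theta^*$ satisfying (C1),(C3)): the associative $\mathbb{F}$-algebra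 with $1$ generated by $a,e_0,\dots,e_d,a^*,e^*_0,\dots,e^*_d$ subject to $e_ie_j=\delta_{ij}e_i$, $e^*_ie^*_j=\delta_{ij}e^*_i$, $\sum_ie_i=1=\sum_ie^*_i$, $a=\sum_i\theta_ie_i$, $a^*=\sum_i\theta^*_ie^*_i$, and $e^*_ia^ke^*_j=0$, $e_i{a^*}^ke_j=0$ whenever $0\le i,j,k\le d$ and $k<|i-j|$. The subspace $e^*_0Te^*_0$ is a commutative $\mathbb{F}$-algebra with identity $e^*_0$ generated by $e^*_0\tau_i(a)e^*_0$ ($1\le i\le d$), so there is a surjective $\mathbb{F}$-algebra homomorphism $\mu:\mathbb{F}[x_1,\dots,x_d]\to e^*_0Te^*_0$ ($x_i$ commuting indeterminates) with $x_i\mapsto e^*_0\tau_i(a)e^*_0$. *)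

(* Defs.v *)
(* Vector space V of finite positive dimension n.+1 is
   modelled as the row space 'rV[F]_n.+1; linear maps are matrices acting
   on the RIGHT (v |-> v *m A), subspaces are row spaces (%MS). *)
From HB Require Import structures.
From mathcomp Require Import all_boot all_order all_algebra.
From mathcomp Require Import mpoly.
Set Implicit Arguments. Unset Strict Implicit. Unset Printing Implicit Defensive.
Import Order.TTheory GRing.Theory Num.Theory.
Local Open Scope ring_scope.

Section TDDefs.
Variable F : fieldType.

(* ---------- scalar conditions (sequences indexed by nat, only 0..d used) *)

Definition tau (th : nat -> F) (i : nat) (x : F) : F :=
  \prod_(j < i) (x - th j).
Definition eta (d : nat) (th : nat -> F) (i : nat) (x : F) : F :=
  \prod_(j < i) (x - th (d - j)%N).

Definition C1 (d : nat) (th ths : nat -> F) : Prop :=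
  (forall i j, (i <= d)%N -> (j <= d)%N -> i <> j -> th i <> th j) /\
  (forall i j, (i <= d)%N -> (j <= d)%N -> i <> j -> ths i <> ths j).

Definition C2 (d : nat) (th ths zeta : nat -> F) : Prop :=
  [/\ zeta 0%N = 1, zeta d <> 0 &
      \sum_(i < d.+1) eta d th (d - i) (th 0%N) * eta d ths (d - i) (ths 0%N)
                       * zeta i <> 0].

Definition C3 (d : nat) (th ths : nat -> F) : Prop :=
  exists c : F, forall i, (2 <= i)%N -> (i.+1 <= d)%N ->
    (th (i - 2)%N - th i.+1) / (th i.-1 - th i) = c /\
    (ths (i - 2)%N - ths i.+1) / (ths i.-1 - ths i) = c.

(* ---------- the algebra T, via its defining relations.  An F-algebra B
   together with elements satisfying the relations of T is a "T-algebra";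
   T is the universal one. *)
Definition T_relations (d : nat) (th ths : nat -> F) (B : algType F)
  (a : B) (e : 'I_d.+1 -> B) (as_ : B) (es : 'I_d.+1 -> B) : Prop :=
  [/\ forall i j : 'I_d.+1, e i * e j = (if i == j then e i else 0),
      forall i j : 'I_d.+1, es i * es j = (if i == j then es i else 0),
      \sum_(i < d.+1) e i = 1 /\ \sum_(i < d.+1) es i = 1,
      a = \sum_(i < d.+1) th i *: e i /\
      as_ = \sum_(i < d.+1) ths i *: es i &
      forall (i j : 'I_d.+1) (k : nat), (k <= d)%N ->
        (k < maxn i j - minn i j)%N ->
        es i * a ^+ k * es j = 0 /\ e i * as_ ^+ k * e j = 0].

Definition tau_alg (th : nat -> F) (i : nat) (B : algType F) (a : B) : B :=
  \prod_(j < i) (a - (th j)%:A).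

(* mu(p) for p in F[x_1..x_d] (variable x_{k+1} is 'X_k, k : 'I_d), computed
   in a T-algebra B: the unital algebra hom into e*_0 B e*_0 sending x_{k+1}
   to e*_0 tau_{k+1}(a) e*_0 (identity of e*_0 B e*_0 is e*_0). *)
Definition mu_eval (d : nat) (th : nat -> F) (B : algType F) (a : B)
  (es0 : B) (p : {mpoly F[d]}) : B :=
  es0 * mmap (fun c : F => c%:A)
             (fun k : 'I_d => es0 * tau_alg th k.+1 a * es0) p * es0.

(* mu : F[x_1..x_d] -> e*_0 T e*_0 is injective: mu(p) = 0 in T means mu(p)
   vanishes in every T-algebra (universal property of T). *)
Definition mu_injective (d : nat) (th ths : nat -> F) : Prop :=
  forall p : {mpoly F[d]},
    (forall (B : algType F) (a : B) (e : 'I_d.+1 -> B) (as_ : B)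
            (es : 'I_d.+1 -> B),
        T_relations th ths a e as_ es -> mu_eval th a (es ord0) p = 0) ->
    p = 0.

(* mu-conjecture over F (mu is always surjective, so isomorphism = injective) *)
Definition mu_conjecture : Prop :=
  forall (d : nat) (th ths : nat -> F), C1 d th ths -> C3 d th ths ->
    mu_injective d th ths.

(* an ordering V_0..V_d of the eigenspaces of A, given by the eigenvalues *)
Definition eigen_ordering n (A : 'M[F]_n.+1) (d : nat) (th : 'I_d.+1 -> F) :=
  [/\ injective th, forall i, eigenvalue A (th i) &
      forall t, eigenvalue A t -> exists i, t = th i].

Definition standard_ordering n (A As : 'M[F]_n.+1) (d : nat)
  (th : 'I_d.+1 -> F) :=
  forall i : 'I_d.+1,
    (eigenspace A (th i) *m As <=
       (if (i : nat) is i'.+1 then eigenspace A (th (inord i')) else 0)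
       + eigenspace A (th i)
       + (if (i < d)%N then eigenspace A (th (inord i.+1)) else 0))%MS.

Definition TD_pair n (A As : 'M[F]_n.+1) : Prop :=
  [/\ diagonalizable A, diagonalizable As,
      exists d (th : 'I_d.+1 -> F),
        eigen_ordering A th /\ standard_ordering A As th,
      exists dl (ths : 'I_dl.+1 -> F),
        eigen_ordering As ths /\ standard_ordering As A ths &
      forall W : 'M[F]_n.+1, (W *m A <= W)%MS -> (W *m As <= W)%MS ->
        \rank W = 0%N \/ \rank W = n.+1].

Definition prim_idem n (A : 'M[F]_n.+1) (d : nat) (th : 'I_d.+1 -> F)
  (i : 'I_d.+1) (E : 'M[F]_n.+1) : Prop :=
  eigenspace A (th i) *m E = eigenspace A (th i) /\
  forall j, j != i -> eigenspace A (th j) *m E = 0.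

Definition TD_system n (d : nat) (A : 'M[F]_n.+1) (E : 'I_d.+1 -> 'M[F]_n.+1)
  (As : 'M[F]_n.+1) (Es : 'I_d.+1 -> 'M[F]_n.+1) : Prop :=
  [/\ TD_pair A As,
      exists th : 'I_d.+1 -> F,
        [/\ eigen_ordering A th, standard_ordering A As th &
            forall i, prim_idem A th i (E i)] &
      exists ths : 'I_d.+1 -> F,
        [/\ eigen_ordering As ths, standard_ordering As A ths &
            forall i, prim_idem As ths i (Es i)]].

Definition eigenvalue_seq n d (A : 'M[F]_n.+1) (E : 'I_d.+1 -> 'M[F]_n.+1)
  (th : nat -> F) : Prop :=
  forall i : 'I_d.+1, E i *m A = th i *: E i.

Definition sharp n d (E : 'I_d.+1 -> 'M[F]_n.+1) : Prop :=
  \rank (E ord0) = 1%N.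

Definition split_seq n d (A : 'M[F]_n.+1) (Es : 'I_d.+1 -> 'M[F]_n.+1)
  (th ths zeta : nat -> F) : Prop :=
  forall i : 'I_d.+1,
    Es ord0 *m (\prod_(j < i) (A - (th j)%:M)) *m Es ord0 =
    (zeta i / \prod_(1 <= j < i.+1) (ths 0%N - ths j)) *: Es ord0.

Definition sharp_TD_system_param n d (A : 'M[F]_n.+1)
  (E : 'I_d.+1 -> 'M[F]_n.+1) (As : 'M[F]_n.+1) (Es : 'I_d.+1 -> 'M[F]_n.+1)
  (th ths zeta : nat -> F) : Prop :=
  [/\ TD_system A E As Es, sharp E, eigenvalue_seq A E th,
      eigenvalue_seq As Es ths & split_seq A Es th ths zeta].

(* isomorphism of tridiagonal systems: a linear bijection sigma : v |-> v *m S
   ('M_(n.+1, m.+1) bijective iff row_free and row_full) intertwining all maps *)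
Definition TD_iso n m d (A : 'M[F]_n.+1) (E : 'I_d.+1 -> 'M[F]_n.+1)
  (As : 'M[F]_n.+1) (Es : 'I_d.+1 -> 'M[F]_n.+1)
  (A' : 'M[F]_m.+1) (E' : 'I_d.+1 -> 'M[F]_m.+1)
  (As' : 'M[F]_m.+1) (Es' : 'I_d.+1 -> 'M[F]_m.+1) : Prop :=
  exists S : 'M[F]_(n.+1, m.+1),
    [/\ row_free S /\ row_full S, A *m S = S *m A', As *m S = S *m As',
        forall i, E i *m S = S *m E' i & forall i, Es i *m S = S *m Es' i].

End TDDefs.

(* Main.v *)
(* Write D for the algebra generated by a, and call es_t D es_r1 D ... D es_u a
   word.  For fixed t, u the elements es_t e_i w(as_) e_j es_u with w monic of
   degree b form a matrix in (i, j) that is banded of width b; when w vanishes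
   at suitable consecutive dual eigenvalues its rows and columns also have about
   b vanishing moments with respect to the th_i.  A banded matrix with enough
   vanishing moments is zero, and one with b vanishing moments on each side is
   symmetric.  This shows that the elements es_0 x es_0 (x in D) commute, that
   they generate es_0 T es_0, and that T es_0 is finitely generated over
   es_0 T es_0, using only (C1).
   Uniqueness: in the direct sum of two systems with the same parameter array,
   es_0 T es_0 acts by scalars on Es_0 (V + V'), so a submodule generated by a
   vector (v, v') of Es_0 (V + V') is the graph of an isomorphism.
   Existence: the mu-conjecture gives a character of es_0 T es_0 with the
   prescribed split sequence; the irreducible quotient of the module it induces
   has finite dimension, and (C2) makes all idempotents nonzero on it.
   Necessity of (C3): a^2 as_ a - a as_ a^2 = p(a) as_ - as_ p(a) for some
   polynomial p, which is shown to be a cubic by sandwiching between es_i and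
   es_j; comparing leading coefficients gives both ratios. *)
Require Import Defs.
From HB Require Import structures.
From mathcomp Require Import all_boot all_order all_algebra.
From mathcomp Require Import mpoly zify ring.
From mathcomp Require boolp.
Set Implicit Arguments. Unset Strict Implicit. Unset Printing Implicit Defensive.
Import GRing.Theory.
Local Open Scope ring_scope.

(** * Vanishing moments of banded matrices *)

(** T is never constructed. Every statement concerns an arbitrary algebra [B] with elements
    satisfying [T_relations], and [gen_alg a as_] stands for the image of T; by (C1) it contains all
    [e i] and [es i], which are polynomials in [a] and [as_]. The same lemmas thus apply to End V,
    to End (V + V') and to the model on which [mu] is injective. The injectivity hypothesis only
    says that each nonzero polynomial survives in some T-algebra, so that model is the product of
    one witness algebra per polynomial. Words are shortened modulo words already under control,
    which is why the lemmas on banded matrices speak of membership in a linear predicate and not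
    only of vanishing. (C2) enters as follows: up to nonzero factors, [es ord0 * e i * es ord0] is
    [es ord0] times zeta_d for i = d, and times the sum in (C2) for i = 0. *)

Definition lin_closed (F : fieldType) (V : lmodType F) (S : V -> Prop) :=
  S 0 /\ forall (c : F) x y, S x -> S y -> S (c *: x + y).

Section LinClosed.
Variables (F : fieldType) (V : lmodType F) (S : V -> Prop).
Hypothesis HS : lin_closed S.

Lemma lc0 : S 0. Proof. by case: HS. Qed.

Lemma lcD x y : S x -> S y -> S (x + y).
Proof. by move=> Sx Sy; rewrite -[x]scale1r; apply: (proj2 HS). Qed.

Lemma lcZ c x : S x -> S (c *: x).
Proof. by move=> Sx; rewrite -[_ *: _]addr0; apply: (proj2 HS) => //; apply: lc0. Qed.

Lemma lc_sum (I : finType) (P : pred I) (f : I -> V) :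
  (forall i, P i -> S (f i)) -> S (\sum_(i | P i) f i).
Proof. by move=> H; apply: big_ind => //; [apply: lc0 | apply: lcD]. Qed.
End LinClosed.

Lemma lin_closed_eq0 (F : fieldType) (V : lmodType F) :
  lin_closed (fun x : V => x = 0).
Proof. by split=> // c x y -> ->; rewrite scaler0 addr0. Qed.

Section Moments.
Variables (F : fieldType) (d : nat) (th : nat -> F).
Hypothesis th_inj : forall i j, (i <= d)%N -> (j <= d)%N -> i <> j -> th i <> th j.

Lemma th_eq (i j : 'I_d.+1) : (th i == th j) = (i == j).
Proof.
apply/eqP/eqP => [|-> //] E; apply/eqP/negPn/negP => /eqP ne.
by apply: (th_inj _ _ _ E) => [||/val_inj //]; rewrite -ltnS.
Qed.

Definition node_poly (I : pred 'I_d.+1) (i : 'I_d.+1) : {poly F} :=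
  \prod_(j | I j && (j != i)) ('X - (th j)%:P).

Lemma size_node_poly (I : pred 'I_d.+1) i : I i -> size (node_poly I i) = #|I|.
Proof.
move=> Ii.
have -> : node_poly I i = \prod_(j <- enum [pred j | I j & j != i]) ('X - (th j)%:P).
  by rewrite big_enum.
by rewrite size_prod_XsubC -cardE -add1n -(cardD1x Ii); apply: eq_card.
Qed.

Lemma horner_node_poly (I : pred 'I_d.+1) (i k : 'I_d.+1) :
  I k -> (node_poly I i).[th k] != 0 = (k == i).
Proof.
move=> Ik; rewrite horner_prod; apply/idP/eqP => [|->].
  apply: contraNeq => ne; rewrite (bigD1 k) ?Ik //= hornerXsubC subrr.
  by rewrite mul0r.
apply/prodf_neq0 => j /andP[_ ne]; rewrite hornerXsubC subr_eq0 th_eq.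
by rewrite eq_sym.
Qed.

(** A polynomial of degree #|I| - 1 vanishing at all nodes of I but th_i isolates f i modulo the
    terms outside I. *)
Lemma moments_vanish (V : lmodType F) (S : V -> Prop) (HS : lin_closed S)
    (I : pred 'I_d.+1) (b : nat) (f : 'I_d.+1 -> V) :
  (#|I| <= b)%N ->
  (forall p : {poly F}, (size p <= b)%N -> S (\sum_(i < d.+1) p.[th i] *: f i)) ->
  (forall i, ~~ I i -> S (f i)) -> forall i, S (f i).
Proof.
move=> leIb Hp Hout i; case: (boolP (I i)) => [Ii|]; last exact: Hout.
set p := node_poly I i.
have szp : (size p <= b)%N by rewrite size_node_poly.
have pi0 : p.[th i] != 0 by rewrite horner_node_poly.
rewrite -[f i]scale1r -(mulVf pi0) -scalerA; apply: (lcZ HS).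
have -> : p.[th i] *: f i =
    (-1) *: (\sum_(j | j != i) p.[th j] *: f j) + \sum_(j < d.+1) p.[th j] *: f j.
  by rewrite [X in _ = _ + X](bigD1 i) //= scaleN1r addrCA addNr addr0.
apply: (proj2 HS); last exact: Hp.
apply: (lc_sum HS) => j ne; case: (boolP (I j)) => [Ij|/Hout]; last exact: (lcZ HS).
have := horner_node_poly i Ij; rewrite (negPf ne) => /negbFE/eqP ->.
by rewrite scale0r; apply: (lc0 HS).
Qed.

Lemma card_interval (lo k : nat) :
  (#|[pred j : 'I_d.+1 | (lo <= j < lo + k)%N]| <= k)%N.
Proof.
rewrite cardE -(size_map val) -[leqRHS](size_iota lo).
apply: uniq_leq_size; first by rewrite (map_inj_uniq val_inj) enum_uniq.
by move=> x /mapP[j]; rewrite mem_enum inE => Hj ->; rewrite mem_iota.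
Qed.

(** Induction on the column k. A row i < k has only the b entries in columns k, ..., k+b-1 left, and
    its b moments settle them; then column k has only the b+1 entries in rows k, ..., k+b left.
    Hence the surplus moment asked of the columns. *)
Lemma band_vanish (V : lmodType F) (S : V -> Prop) (HS : lin_closed S)
    (b : nat) (m : 'I_d.+1 -> 'I_d.+1 -> V) :
  (forall i j : 'I_d.+1, (b < maxn i j - minn i j)%N -> S (m i j)) ->
  (forall j (p : {poly F}), (size p <= b.+1)%N -> S (\sum_(i < d.+1) p.[th i] *: m i j)) ->
  (forall i (p : {poly F}), (size p <= b)%N -> S (\sum_(j < d.+1) p.[th j] *: m i j)) ->
  forall i j, S (m i j).
Proof.
move=> Hband Hcol Hrow i j.
elim/ltn_ind: {j}(j : nat) {-2}j (erefl (j : nat)) i => k IH j jk.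
have row0 (i : 'I_d.+1) : (i < k)%N -> forall j', S (m i j').
  move=> lik.
  apply: (moments_vanish HS (card_interval k b)) => [p|j' /= Hj'].
    exact: Hrow.
  case: (ltnP j' k) => [lt|ge]; first exact: (IH _ lt).
  by apply: Hband; lia.
apply: (moments_vanish HS (card_interval k b.+1)) => [p|i /= Hi].
  exact: Hcol.
by case: (ltnP i k) => [/row0 //|ge]; apply: Hband; lia.
Qed.

(** Induction on the row k. Antisymmetry settles the columns before k, so only the b entries in
    columns k+1, ..., k+b remain; the zero diagonal replaces the surplus moment of [band_vanish]. *)
Lemma alternating_band_vanish (V : lmodType F) (b : nat)
    (m : 'I_d.+1 -> 'I_d.+1 -> V) :
  (forall i, m i i = 0) -> (forall i j, m j i = - m i j) ->
  (forall i j : 'I_d.+1, (b < maxn i j - minn i j)%N -> m i j = 0) ->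
  (forall i (p : {poly F}), (size p <= b)%N -> \sum_(j < d.+1) p.[th j] *: m i j = 0) ->
  forall i j, m i j = 0.
Proof.
move=> Hdiag Halt Hband Hrow i.
elim/ltn_ind: {i}(i : nat) {-2}i (erefl (i : nat)) => k IH i ik.
apply: (moments_vanish (lin_closed_eq0 V) (card_interval k.+1 b)) => [p|j /= Hj].
  exact: Hrow.
case: (ltngtP j k) => [lt|gt|/= eq]; first by rewrite Halt (IH _ lt) ?oppr0.
  by apply: Hband; lia.
by rewrite (_ : j = i) //; apply: val_inj; rewrite /= eq.
Qed.

End Moments.

(** * Spectral idempotents *)

Lemma horner_algP (F : fieldType) (B : algType F) (x : B) c (p q : {poly F}) :
  horner_alg x (c *: p + q) = c *: horner_alg x p + horner_alg x q.
Proof. by rewrite rmorphD /= -mul_polyC rmorphM /= horner_algC mulr_algl. Qed.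

Section Spectral.
Variables (F : fieldType) (d : nat) (th : nat -> F) (B : algType F).
Variables (a : B) (e : 'I_d.+1 -> B).
Hypothesis eM : forall i j, e i * e j = if i == j then e i else 0.
Hypothesis e1 : \sum_i e i = 1.
Hypothesis aE : a = \sum_(i < d.+1) th i *: e i.

Lemma sum_idemM (c : 'I_d.+1 -> F) i : (\sum_j c j *: e j) * e i = c i *: e i.
Proof.
rewrite mulr_suml (bigD1 i) //= -scalerAl eM eqxx big1 ?addr0 // => j ne.
by rewrite -scalerAl eM (negPf ne) scaler0.
Qed.

Lemma idem_sumM (c : 'I_d.+1 -> F) i : e i * (\sum_j c j *: e j) = c i *: e i.
Proof.
rewrite mulr_sumr (bigD1 i) //= -scalerAr eM eqxx big1 ?addr0 // => j ne.
by rewrite -scalerAr eM eq_sym (negPf ne) scaler0.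
Qed.

Lemma idem_ext (x y : B) : (forall i, e i * x = e i * y) -> x = y.
Proof.
by move=> H; rewrite -[x]mul1r -[y]mul1r -e1 !mulr_suml; apply: eq_bigr.
Qed.

Lemma idem_ext2 (x y : B) :
  (forall i j, e i * x * e j = e i * y * e j) -> x = y.
Proof.
move=> H; apply: idem_ext => i; rewrite -[LHS]mulr1 -[RHS]mulr1 -e1 !mulr_sumr.
exact: eq_bigr.
Qed.

Lemma idem_horner i p : e i * horner_alg a p = p.[th i] *: e i.
Proof.
elim/poly_ind: p => [|p c IH]; first by rewrite rmorph0 mulr0 horner0 scale0r.
rewrite rmorphD rmorphM /= horner_algX horner_algC mulrDr mulrA IH.
rewrite hornerMXaddC -scalerAl aE idem_sumM scalerA -scalerAr mulr1.
by rewrite scalerDl.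
Qed.

Lemma horner_algE p : horner_alg a p = \sum_(i < d.+1) p.[th i] *: e i.
Proof. by apply: idem_ext => i; rewrite idem_horner idem_sumM. Qed.

Lemma horner_idem i p : horner_alg a p * e i = p.[th i] *: e i.
Proof. by rewrite horner_algE sum_idemM. Qed.

Lemma idem_a i : e i * a = th i *: e i.
Proof. by rewrite aE idem_sumM. Qed.

Lemma a_idem i : a * e i = th i *: e i.
Proof. by rewrite aE sum_idemM. Qed.

Hypothesis th_inj : forall i j, (i <= d)%N -> (j <= d)%N -> i <> j -> th i <> th j.

Definition lagrange_node (i : 'I_d.+1) : {poly F} :=
  (node_poly th predT i).[th i]^-1 *: node_poly th predT i.

Lemma horner_lagrange_node (i j : 'I_d.+1) :
  (lagrange_node i).[th j] = (j == i)%:R.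
Proof.
rewrite hornerZ; have := horner_node_poly th_inj i (isT : predT j).
have : (node_poly th predT i).[th i] != 0 by rewrite horner_node_poly.
case: (altP (j =P i)) => [->|_] h0 h1; first by rewrite mulVf.
by rewrite (eqP (negbFE h1)) mulr0.
Qed.

Lemma size_lagrange_node i : (size (lagrange_node i) <= d.+1)%N.
Proof.
rewrite (leq_trans (size_scale_leq _ _)) // size_node_poly //.
by rewrite (leq_trans (max_card _)) ?card_ord.
Qed.

Lemma idem_poly i : e i = horner_alg a (lagrange_node i).
Proof.
apply: idem_ext => j; rewrite idem_horner horner_lagrange_node eM.
by case: eqP => [->|_]; rewrite ?scale1r ?scale0r.
Qed.

Lemma interpolation (c : nat -> F) : exists2 p : {poly F},
  (size p <= d.+1)%N & forall i, (i <= d)%N -> p.[th i] = c i.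
Proof.
exists (\sum_(i < d.+1) c i *: lagrange_node i).
  apply: (big_ind (fun p : {poly F} => (size p <= d.+1)%N)) => //.
  - by rewrite size_poly0.
  - by move=> p q sp sq; rewrite (leq_trans (size_polyD _ _)) // geq_max sp.
  by move=> i _; rewrite (leq_trans (size_scale_leq _ _)) ?size_lagrange_node.
move=> i; rewrite -ltnS => lid; rewrite horner_sum (bigD1 (Ordinal lid)) //=.
rewrite hornerZ (horner_lagrange_node _ (Ordinal lid)) eqxx mulr1 big1 ?addr0 //.
move=> j ne; rewrite hornerZ (horner_lagrange_node _ (Ordinal lid)) eq_sym.
by rewrite (negPf ne) mulr0.
Qed.

End Spectral.

Lemma horner_alg_band (F : fieldType) (B : algType F) (u v x : B) (k : nat)
    (p : {poly F}) :
  (forall i, (i < k)%N -> u * x ^+ i * v = 0) -> (size p <= k)%N ->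
  u * horner_alg x p * v = 0.
Proof.
move=> H sp; rewrite -[p]coefK poly_def rmorph_sum /= mulr_sumr mulr_suml.
apply: big1 => i _; rewrite -mul_polyC rmorphM /= horner_algC rmorphXn /=.
by rewrite horner_algX mulr_algl -scalerAr -scalerAl H ?scaler0 // (leq_trans _ sp).
Qed.

Section Trel.
Variables (F : fieldType) (d : nat) (th ths : nat -> F) (B : algType F).
Variables (a : B) (e : 'I_d.+1 -> B) (as_ : B) (es : 'I_d.+1 -> B).
Hypothesis HT : T_relations th ths a e as_ es.

Lemma T_relations_dual : T_relations ths th as_ es a e.
Proof.
case: HT => [H1 H2 [H3 H4] [H5 H6] H7]; split=> // i j k lk lt.
by case: (H7 i j k lk lt).
Qed.

Lemma T_idemM i j : e i * e j = if i == j then e i else 0.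
Proof. by case: HT. Qed.
Lemma T_idem1 : \sum_i e i = 1. Proof. by case: HT => ? ? []. Qed.
Lemma T_aE : a = \sum_(i < d.+1) th i *: e i. Proof. by case: HT => ? ? ? []. Qed.

Lemma T_band (i j : 'I_d.+1) (w : {poly F}) :
  (size w <= maxn i j - minn i j)%N -> e i * horner_alg as_ w * e j = 0.
Proof.
apply: horner_alg_band => k lk; case: HT => _ _ _ _ /(_ i j k).
case=> //; by have := ltn_ord i; have := ltn_ord j; lia.
Qed.

End Trel.

(** * Words *)

Section Reduction.
Variables (F : fieldType) (d : nat) (th ths : nat -> F) (B : algType F).
Variables (a : B) (e : 'I_d.+1 -> B) (as_ : B) (es : 'I_d.+1 -> B).
Hypothesis HT : T_relations th ths a e as_ es.
Hypothesis HC1 : C1 d th ths.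

Implicit Types (p q w : {poly F}) (i j r s : 'I_d.+1).

Let HTd := T_relations_dual HT.
Local Notation pa := (horner_alg a).
Local Notation pas := (horner_alg as_).
Let th_inj := proj1 HC1.
Let ths_inj := proj2 HC1.

Let paE p : pa p = \sum_(i < d.+1) p.[th i] *: e i.
Proof. exact: (horner_algE (T_idemM HT) (T_idem1 HT) (T_aE HT)). Qed.
Let pasE p : pas p = \sum_(i < d.+1) p.[ths i] *: es i.
Proof. exact: (horner_algE (T_idemM HTd) (T_idem1 HTd) (T_aE HTd)). Qed.
Let e_pa i : e i = pa (lagrange_node th i).
Proof. exact: (idem_poly (T_idemM HT) (T_idem1 HT) (T_aE HT) th_inj). Qed.
Let es_pas i : es i = pas (lagrange_node ths i).
Proof. exact: (idem_poly (T_idemM HTd) (T_idem1 HTd) (T_aE HTd) ths_inj). Qed.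

(** Newton basis starting at the node of index m. With [th] in place of [ths] and m = 0 it is the
    sequence tau. *)
Definition node_prod (m b : nat) : {poly F} := \prod_(s < b) ('X - (ths (m + s))%:P).

Lemma node_prod_monic m b : node_prod m b \is monic.
Proof. exact: monic_prod_XsubC. Qed.

Lemma size_node_prod m b : size (node_prod m b) = b.+1.
Proof. by rewrite /node_prod size_prod_XsubC /index_enum -enumT size_enum_ord. Qed.

Lemma horner_node_prod_eq0 m b s :
  (m <= s < m + b)%N -> (node_prod m b).[ths s] = 0.
Proof.
move=> /andP[ms sb]; have lt : (s - m < b)%N by lia.
rewrite horner_prod (bigD1 (Ordinal lt)) //= hornerXsubC subnKC // subrr.
by rewrite mul0r.
Qed.

Lemma poly_node_prod_ind m (P : {poly F} -> Prop) :
  P 0 -> (forall b c w, P w -> P (c *: node_prod m b + w)) -> forall w, P w.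
Proof.
move=> P0 PS w; elim: {w}(size w) {-2}w (leqnn (size w)) => [|b IH] w.
  by rewrite leqn0 size_poly_eq0 => /eqP ->.
move=> sw; rewrite -[w](subrK (w`_b *: node_prod m b)) addrC; apply: PS.
apply: IH; apply/leq_sizeP => k lbk; rewrite coefB coefZ.
have lw := size_node_prod m b.
case: (ltngtP b k) lbk => // [ltbk _|<- _].
  rewrite (nth_default _ (leq_trans sw ltbk)).
  by rewrite [X in _ - _ * X]nth_default ?mulr0 ?subr0 // lw.
have /monicP := node_prod_monic m b; rewrite lead_coefE lw /= => ->.
by rewrite mulr1 subrr.
Qed.

Section Reduce.
Variables (t u : 'I_d.+1) (m : nat) (S : B -> Prop).
Hypotheses (tm : (t <= m)%N) (um : (u <= m)%N) (HS : lin_closed S).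
Hypothesis Hlow : forall (s : 'I_d.+1) p q, (s < m)%N ->
  S (es t * pa p * es s * pa q * es u).

(** Expand w(as_) over the [es s]. Terms with s < m lie in S by [Hlow], those with m <= s < m + b
    are killed by w, and for s >= m + b the degree of p is too small to go from t to s. When t < m
    the distance grows by one, which gives the surplus moment. *)
Let left_moments b j p : (size p <= b + (t < m))%N ->
  S (\sum_(i < d.+1) p.[th i] *:
       (es t * e i * pas (node_prod m b) * e j * es u)).
Proof.
move=> sp; under eq_bigr do rewrite 3!scalerAl scalerAr.
rewrite -!mulr_suml -mulr_sumr -paE pasE mulr_sumr !mulr_suml.
apply: (lc_sum HS) => s _; rewrite -scalerAr -!scalerAl e_pa.
case: (ltnP s m) => sm; first by apply/(lcZ HS)/Hlow.
case: (ltnP s (m + b)) => smb.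
  by rewrite horner_node_prod_eq0 ?sm // scale0r; apply: lc0.
rewrite (T_band HTd) ?mul0r ?scaler0; first exact: lc0.
by apply: leq_trans sp _; lia.
Qed.

Let right_moments b i p : (size p <= b + (u < m))%N ->
  S (\sum_(j < d.+1) p.[th j] *:
       (es t * e i * pas (node_prod m b) * e j * es u)).
Proof.
move=> sp; under eq_bigr do rewrite scalerAl scalerAr.
rewrite -!mulr_suml -mulr_sumr -paE pasE mulr_sumr !mulr_suml.
apply: (lc_sum HS) => s _; rewrite -scalerAr -!scalerAl e_pa.
case: (ltnP s m) => sm; first by apply/(lcZ HS)/Hlow.
case: (ltnP s (m + b)) => smb.
  by rewrite horner_node_prod_eq0 ?sm // scale0r; apply: lc0.
rewrite -2!mulrA [es s * _]mulrA (T_band HTd) ?mulr0 ?scaler0; first exact: lc0.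
by apply: leq_trans sp _; lia.
Qed.

(* The matrices [es t * e i * w(as_) * e j * es u], for [w] the monic
   polynomial of degree [b] vanishing at [ths m, ..., ths (m + b - 1)], are
   banded modulo [S] and have enough vanishing moments modulo [S]. *)
Lemma reduce_word : (t < m)%N || (u < m)%N -> forall r p q,
  S (es t * pa p * es r * pa q * es u).
Proof.
move=> tum; suff H w i j : S (es t * e i * pas w * e j * es u).
  move=> r p q; rewrite paE mulr_sumr !mulr_suml; apply: (lc_sum HS) => i _.
  rewrite [pa q]paE mulr_sumr mulr_suml; apply: (lc_sum HS) => j _.
  rewrite -scalerAr -!scalerAl; apply: (lcZ HS); rewrite -scalerAr -!scalerAl.
  apply: (lcZ HS); rewrite [es r]es_pas.
  exact: H.
elim/(@poly_node_prod_ind m): w => [|b c w IH].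
  by rewrite rmorph0 mulr0 !mul0r; apply: lc0.
have -> : es t * e i * pas (c *: node_prod m b + w) * e j * es u =
    c *: (es t * e i * pas (node_prod m b) * e j * es u) +
    es t * e i * pas w * e j * es u.
  by rewrite horner_algP mulrDr !mulrDl -scalerAr -!scalerAl.
apply: (proj2 HS) => //.
have Hband (i' j' : 'I_d.+1) : (b < maxn i' j' - minn i' j')%N ->
    S (es t * e i' * pas (node_prod m b) * e j' * es u).
  move=> lt; rewrite -!mulrA [pas _ * _]mulrA [e i' * _]mulrA [e i' * _]mulrA.
  by rewrite (T_band HT) ?size_node_prod // mul0r mulr0; apply: lc0.
case/orP: tum => lt.
  apply: (band_vanish th_inj HS Hband) => [j' p sp|i' p sp].
    by apply: left_moments; rewrite lt addn1.
  by apply: right_moments; rewrite (leq_trans sp) ?leq_addr.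
(* Here the surplus moment is on the right, so the transposed matrix is used. *)
apply: (band_vanish th_inj HS (m := fun j' i' =>
    es t * e i' * pas (node_prod m b) * e j' * es u)) => [j' i' |i' p sp|j' p sp].
- by rewrite maxnC minnC; apply: Hband.
- by apply: right_moments; rewrite lt addn1.
by apply: left_moments; rewrite (leq_trans sp) ?leq_addr.
Qed.

End Reduce.

(* Antisymmetrise [es0 * e i * w(as_) * e j * es0] in [i, j], for [w] the monic
   polynomial of degree [b] vanishing at [ths 0, ..., ths (b - 1)]. *)
Lemma es0_symmetric p q w :
  es ord0 * pa p * pas w * pa q * es ord0 =
  es ord0 * pa q * pas w * pa p * es ord0.
Proof.
set es0 := es ord0; pose m w i j := es0 * e i * pas w * e j * es0.
suff H i j : m w i j = m w j i.
  have X p' q' : es0 * pa p' * pas w * pa q' * es0 =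
      \sum_(i < d.+1) \sum_(j < d.+1) (p'.[th i] * q'.[th j]) *: m w i j.
    rewrite [pa p']paE mulr_sumr !mulr_suml; apply: eq_bigr => i _.
    rewrite [pa q']paE mulr_sumr mulr_suml; apply: eq_bigr => j _.
    by rewrite -scalerAr -!scalerAl -scalerAr -!scalerAl scalerA [in RHS]mulrC.
  rewrite !X exchange_big /=; apply: eq_bigr => i _; apply: eq_bigr => j _.
  by rewrite mulrC H.
clear p q; elim/(@poly_node_prod_ind 0): w i j => [|b c w IH] i j.
  by rewrite /m rmorph0 !mulr0 !mul0r.
have mP i' j' : m (c *: node_prod 0 b + w) i' j' =
    c *: m (node_prod 0 b) i' j' + m w i' j'.
  by rewrite /m horner_algP mulrDr !mulrDl -scalerAr -!scalerAl.
rewrite !mP IH; congr (_ *: _ + _); apply/eqP; rewrite -subr_eq0; apply/eqP.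
move: (node_prod 0 b) (size_node_prod 0 b) (@horner_node_prod_eq0 0 b) => v sv v0.
(* With both ends at index 0 and nodes starting at 0 there are no lower words: the b moments vanish
   exactly, on each side. *)
have row0 p : (size p <= b)%N -> es0 * pa p * pas v = 0.
  move=> sp; rewrite pasE mulr_sumr big1 // => s _.
  case: (ltnP s b) => sb; first by rewrite v0 // scale0r mulr0.
  by rewrite -scalerAr (T_band HTd) ?scaler0 // (leq_trans sp) //=; lia.
have col0 p : (size p <= b)%N -> pas v * (pa p * es0) = 0.
  move=> sp; rewrite pasE mulr_suml big1 // => s _.
  case: (ltnP s b) => sb; first by rewrite v0 // scale0r mul0r.
  rewrite mulrA -!scalerAl (T_band HTd) ?scaler0 // (leq_trans sp) //=; lia.
have v_band (i' j' : 'I_d.+1) : (b < maxn i' j' - minn i' j')%N -> m v i' j' = 0.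
  move=> lt; rewrite /m -!mulrA [pas _ * _]mulrA [e i' * _]mulrA [e i' * _]mulrA.
  by rewrite (T_band HT) ?sv // mul0r mulr0.
apply: (alternating_band_vanish th_inj (b := b)
  (m := fun i' j' => m v i' j' - m v j' i')) => [i'|i' j'|i' j' lt|i' p sp].
- by rewrite subrr.
- by rewrite opprB.
- by rewrite !v_band ?subrr // maxnC minnC.
under eq_bigr do rewrite scalerBr; rewrite sumrB.
have -> : \sum_(j < d.+1) p.[th j] *: m v i' j =
    es0 * e i' * (pas v * (pa p * es0)).
  rewrite !mulrA paE mulr_sumr mulr_suml; apply: eq_bigr => k _.
  by rewrite -scalerAr -scalerAl.
have -> : \sum_(j < d.+1) p.[th j] *: m v j i' = es0 * pa p * pas v * e i' * es0.
  rewrite paE mulr_sumr !mulr_suml; apply: eq_bigr => k _.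
  by rewrite -scalerAr -!scalerAl.
by rewrite row0 // col0 // mulr0 !mul0r subrr.
Qed.
End Reduction.

(** * The image of T in a T-algebra, and words with bounded interior indices *)

Inductive gen_alg (F : fieldType) (B : algType F) (a as_ : B) : B -> Prop :=
| gen1 : gen_alg a as_ 1
| gen_a : gen_alg a as_ a
| gen_as : gen_alg a as_ as_
| genM x y : gen_alg a as_ x -> gen_alg a as_ y -> gen_alg a as_ (x * y)
| genP c x y : gen_alg a as_ x -> gen_alg a as_ y -> gen_alg a as_ (c *: x + y).

Section GenAlg.
Variables (F : fieldType) (B : algType F) (a as_ : B).
Let gen := gen_alg a as_.

Lemma gen_lin_closed : lin_closed gen.
Proof.
split=> [|c x y]; last exact: genP.
by rewrite -(addNr (1 : B)) -scaleN1r; apply: genP; apply: gen1.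
Qed.

Lemma gen_horner x p : gen x -> gen (horner_alg x p).
Proof.
move=> gx; elim/poly_ind: p => [|p c IH].
  by rewrite rmorph0; apply: (lc0 gen_lin_closed).
rewrite rmorphD rmorphM /= horner_algX horner_algC; apply: (lcD gen_lin_closed).
  exact: genM.
exact/(lcZ gen_lin_closed)/gen1.
Qed.

End GenAlg.

(* [word_span a es m u t] is the span of the words
   es t * D * es r1 * D * ... * D * es u, D the algebra generated by [a],
   whose interior indices r1, r2, ... are below [m]. *)
Inductive word_span (F : fieldType) (d : nat) (B : algType F) (a : B)
    (es : 'I_d.+1 -> B) (m : nat) (u : 'I_d.+1) : 'I_d.+1 -> B -> Prop :=
| span_word (t : 'I_d.+1) (p : {poly F}) :
    word_span a es m u t (es t * horner_alg a p * es u)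
| span_lin (t : 'I_d.+1) (c : F) (x y : B) :
    word_span a es m u t x -> word_span a es m u t y ->
    word_span a es m u t (c *: x + y)
| span_step (t r : 'I_d.+1) (p : {poly F}) (x : B) : (r < m)%N -> word_span a es m u r x ->
    word_span a es m u t (es t * horner_alg a p * x).

Section Paths.
Variables (F : fieldType) (d : nat) (th ths : nat -> F) (B : algType F).
Variables (a : B) (e : 'I_d.+1 -> B) (as_ : B) (es : 'I_d.+1 -> B).
Hypothesis HT : T_relations th ths a e as_ es.
Hypothesis HC1 : C1 d th ths.
Implicit Types (p q : {poly F}) (i j r s t u : 'I_d.+1) (m : nat).

Let HTd := T_relations_dual HT.
Local Notation pa := (horner_alg a).
Local Notation span := (word_span a es).
Local Notation gen := (gen_alg a as_).

Lemma span_lin_closed m u t : lin_closed (span m u t).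
Proof.
split=> [|c x y]; last exact: span_lin.
have := span_word a es m u t 0; by rewrite rmorph0 mulr0 mul0r.
Qed.

Lemma span_mulr_closed m u t z : lin_closed (fun x => span m u t (x * z)).
Proof.
split=> [|c x y Hx Hy]; first by rewrite mul0r; apply: (lc0 (span_lin_closed _ _ _)).
by rewrite mulrDl -scalerAl; apply: span_lin.
Qed.

Lemma esM i j : es i * es j = if i == j then es i else 0.
Proof. exact: (T_idemM HTd). Qed.

Lemma esK i : es i * es i = es i. Proof. by rewrite esM eqxx. Qed.

Lemma span_esl m u t x : span m u t x -> es t * x = x.
Proof.
elim=> {t x} [t p|t c x y _ Hx _ Hy|t r p x _ _ _]; last by rewrite !mulrA esK.
  by rewrite !mulrA esK.
by rewrite mulrDr -scalerAr Hx Hy.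
Qed.

Lemma span_esr m u t x : span m u t x -> x * es u = x.
Proof.
elim=> {t x} [t p|t c x y _ Hx _ Hy|t r p x _ _ H]; last by rewrite -mulrA H.
  by rewrite -mulrA esK.
by rewrite mulrDl -scalerAl Hx Hy.
Qed.

Lemma gen_es i : gen (es i).
Proof.
rewrite (idem_poly (T_idemM HTd) (T_idem1 HTd) (T_aE HTd) (proj2 HC1)).
exact/gen_horner/gen_as.
Qed.

Lemma gen_e i : gen (e i).
Proof.
rewrite (idem_poly (T_idemM HT) (T_idem1 HT) (T_aE HT) (proj1 HC1)).
exact/gen_horner/gen_a.
Qed.

Lemma gen_pa p : gen (pa p). Proof. exact/gen_horner/gen_a. Qed.

Lemma span_gen m u t x : span m u t x -> gen x.
Proof.
elim=> {t x} [t p|t c x y _ Hx _ Hy|t r p x _ _ H]; last first.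
- exact: genM (genM (gen_es _) (gen_pa _)) H.
- exact: genP.
exact: genM (genM (gen_es _) (gen_pa _)) (gen_es _).
Qed.

(** [as_] is absorbed by [es t], and a product is cut by inserting the sum of all [es s], which is
    1. *)
Lemma gen_span_mul u x : gen x ->
  forall t r y, span d.+1 u r y -> span d.+1 u t (es t * x * y).
Proof.
elim=> {x} [t r y Hy|t r y Hy|t r y Hy|x y _ IHx _ IHy t r z Hz|
            c x y _ IHx _ IHy t r z Hz].
- rewrite mulr1 -(span_esl Hy) mulrA esM; case: eqP => [->|_].
    by rewrite (span_esl Hy).
  by rewrite mul0r; apply: (lc0 (span_lin_closed _ _ _)).
- by have := span_step t 'X (ltn_ord r) Hy; rewrite horner_algX.
- rewrite (idem_a (T_idemM HTd) (T_aE HTd)) -scalerAl.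
  apply: (lcZ (span_lin_closed _ _ _)).
  rewrite -(span_esl Hy) mulrA esM; case: eqP => [->|_].
    by rewrite (span_esl Hy).
  by rewrite mul0r; apply: (lc0 (span_lin_closed _ _ _)).
- have -> : es t * (x * y) * z = \sum_s es t * x * (es s * y * z).
    by rewrite -mulr_sumr -2!mulr_suml (T_idem1 HTd) mul1r !mulrA.
  by apply: (lc_sum (span_lin_closed _ _ _)) => s _; apply: IHx (IHy _ _ _ Hz).
rewrite mulrDr mulrDl -scalerAr -scalerAl; apply: span_lin; first exact: IHx Hz.
exact: IHy Hz.
Qed.

Lemma gen_span u t x : gen x -> span d.+1 u t (es t * x * es u).
Proof.
move=> gx; have := span_word a es d.+1 u u 1; rewrite rmorph1 mulr1 esK.
exact: gen_span_mul.
Qed.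

(** [reduce_word] removes the index m from the first interior position. When a longer word x
    follows, it is carried along as a right factor: the reduction runs in the predicate of those y
    with y * x in the span, and the end index is the start of x. *)
Lemma span_lower_step m u r x : (u <= m)%N -> span m.+1 u r x ->
  forall t p, (t < m)%N -> span m u t (es t * pa p * x).
Proof.
move=> um; elim=> {r x} [r p'|r c x y _ Hx _ Hy|r r' p' x r'm Hx IH] t p tm.
- rewrite !mulrA; apply: (reduce_word HT HC1 _ um (span_lin_closed m u t)).
  + exact: ltnW.
  + move=> s q q' sm; rewrite -!mulrA mulrA [es s * _]mulrA.
    exact: span_step sm (span_word _ _ _ _ _ _).
  by rewrite tm.
- rewrite mulrDr -scalerAr; apply: span_lin; [exact: Hx|exact: Hy].
rewrite !mulrA -(span_esl Hx) mulrA.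
apply: (reduce_word HT HC1 (ltnW tm) _ (span_mulr_closed _ _ _ _));
  rewrite ?tm // => s q q' sm.
rewrite -!mulrA (span_esl Hx) mulrA [es s * _]mulrA.
exact: span_step sm (IH _ _ sm).
Qed.

Lemma span_lower m u t x : (t < m)%N -> (u <= m)%N ->
  span m.+1 u t x -> span m u t x.
Proof.
move=> tm um H; elim: {t x}H tm => [t p|t c x y _ Hx _ Hy|t r p x _ Hx _] tm.
- exact: span_word.
- by apply: span_lin; [apply: Hx|apply: Hy].
exact: span_lower_step Hx _ _ tm.
Qed.

(** The start is now m itself, so [reduce_word] has to take its strict inequality from the right
    end: u, or the next interior index of x. *)
Lemma span_loop m u r x : (u < m)%N -> span m u r x ->
  forall t p, t = m :> nat -> span m u t (es t * pa p * x).
Proof.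
move=> um H; elim: {r x}H => [r p'|r c x y _ Hx _ Hy|r r' p' x r'm Hx _] t p tm.
- rewrite !mulrA; apply: (reduce_word HT HC1 (m := m) _ _ (span_lin_closed m u t)).
  + by rewrite tm.
  + exact: ltnW.
  + move=> s q q' sm; rewrite -!mulrA mulrA [es s * _]mulrA.
    exact: span_step sm (span_word _ _ _ _ _ _).
  by rewrite um orbT.
- by rewrite mulrDr -scalerAr; apply: span_lin; [apply: Hx|apply: Hy].
rewrite !mulrA -(span_esl Hx) mulrA.
apply: (reduce_word HT HC1 (m := m) _ _ (span_mulr_closed _ _ _ _)).
- by rewrite tm.
- exact: ltnW.
- move=> s q q' sm; rewrite -!mulrA (span_esl Hx) mulrA [es s * _]mulrA.
  exact: span_step sm (span_step _ _ r'm Hx).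
by rewrite r'm orbT.
Qed.

Lemma span_top m u r x : (u < m)%N -> span m.+1 u r x -> (r <= m)%N ->
  forall t p, t = m :> nat -> span m u t (es t * pa p * x).
Proof.
move=> um H; elim: {r x}H => [r p'|r c x y _ Hx _ Hy|r r' p' x r'm Hx IH] rm t p tm.
- by apply: (span_loop um (r := r)) => //; apply: span_word.
- by rewrite mulrDr -scalerAr; apply: span_lin; [apply: Hx|apply: Hy].
case: (ltnP r m) => [lt|ge].
  apply: (span_step _ _ lt); apply: span_lower_step Hx _ _ lt; exact: ltnW.
by apply: (span_loop um (r := r)) => //; apply: IH => //; lia.
Qed.

Lemma span_descend m k u t x : (t < m)%N -> (u <= m)%N ->
  span (m + k) u t x -> span m u t x.
Proof.
move=> tm um; elim: k => [|k IH]; first by rewrite addn0.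
by rewrite addnS => /span_lower H; apply/IH/H; lia.
Qed.

Lemma gen_span_low m u t x : (t < m <= d.+1)%N -> (u <= m)%N -> gen x ->
  span m u t (es t * x * es u).
Proof.
move=> /andP[tm md] um gx; apply: (span_descend (k := (d.+1 - m)%N) tm um).
by rewrite subnKC //; apply: gen_span.
Qed.

Lemma span_lower_top m u t x : (u < m)%N -> span m.+1 u t x -> t = m :> nat ->
  span m u t x.
Proof.
move=> um; elim=> {t x} [t p|t c x y _ Hx _ Hy|t r p x rm Hx _] tm.
- exact: span_word.
- by apply: span_lin; [apply: Hx|apply: Hy].
exact: (span_top um Hx rm).
Qed.

(** A word from t down to u < t can be rewritten so as to pass only through indices below t. This
    drives the induction in [finitely_generated]. *)
Lemma gen_span_top u t x : (u < t)%N -> gen x -> span t u t (es t * x * es u).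
Proof.
move=> ut gx; apply: span_lower_top => //; apply: gen_span_low => //.
  by rewrite ltnSn ltn_ord.
exact: leqW (ltnW ut).
Qed.

(** For m = 1 the only interior index is 0, so the words are products of elements
    [es ord0 * pa p * es ord0]. *)
Lemma es0_gen_ind (S : B -> Prop) : lin_closed S ->
  (forall p, S (es ord0 * pa p * es ord0)) ->
  (forall p y, S y -> S (es ord0 * pa p * es ord0 * y)) ->
  forall x, gen x -> S (es ord0 * x * es ord0).
Proof.
move=> HS H0 H1 x gx; have := @gen_span_low 1 ord0 ord0 x isT isT gx.
suff H t y : span 1 ord0 t y -> t = ord0 -> S y by move/H; apply.
elim=> {t y} [t p -> //|t c y z _ Hy _ Hz t0|t r p y r1 Hy IH ->].
  by apply: (proj2 HS); [apply: Hy|apply: Hz].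
have r0 : r = ord0 by apply: val_inj => /=; lia.
by rewrite -(span_esl Hy) mulrA {1}r0; apply/H1/IH.
Qed.

Lemma tau_algE k : tau_alg th k a = pa (node_prod th 0 k).
Proof.
rewrite /tau_alg /node_prod rmorph_prod; apply: eq_bigr => i _.
by rewrite rmorphB /= horner_algX horner_algC add0n.
Qed.

Lemma horner_alg_tau_ind (S : B -> Prop) : lin_closed S ->
  (forall k, (k <= d)%N -> S (tau_alg th k a)) -> forall p, S (pa p).
Proof.
move=> HS H; apply: (poly_node_prod_ind (ths := th) (m := 0%N)) => [|b c w Hw].
  by rewrite rmorph0; apply: lc0.
rewrite horner_algP; apply: (proj2 HS) => //; rewrite -tau_algE.
(* Beyond d the polynomial tau_b vanishes at every eigenvalue, so tau_b(a) = 0. *)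
case: (leqP b d) => bd; first exact: H.
rewrite tau_algE (horner_algE (T_idemM HT) (T_idem1 HT) (T_aE HT)) big1 => [|i _].
  exact: lc0.
rewrite horner_node_prod_eq0 ?scale0r // add0n /=.
exact: leq_trans (ltn_ord i) bd.
Qed.

Inductive rspan (ws : seq B) : B -> Prop :=
| rspan0 : rspan ws 0
| rspanD x y : rspan ws x -> rspan ws y -> rspan ws (x + y)
| rspanM (w g : B) : w \in ws -> gen g -> rspan ws (w * (es ord0 * g * es ord0)).

Lemma rspan_lin_closed ws : lin_closed (rspan ws).
Proof.
split=> [|c x y Hx Hy]; first exact: rspan0.
apply: rspanD Hy; elim: Hx => {x y}[|x y _ Hx _ Hy|w g wws gg].
- by rewrite scaler0; apply: rspan0.
- by rewrite scalerDr; apply: rspanD.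
rewrite scalerAr scalerAl scalerAr; apply: rspanM => //.
exact: (lcZ (gen_lin_closed _ _)).
Qed.

Lemma rspan_mull ws ws' y x : {subset [seq y * w | w <- ws] <= ws'} ->
  rspan ws x -> rspan ws' (y * x).
Proof.
move=> sub; elim=> {x}[|x z _ Hx _ Hz|w g wws gg].
- by rewrite mulr0; apply: rspan0.
- by rewrite mulrDr; apply: rspanD.
by rewrite mulrA; apply: rspanM => //; apply: sub; apply: map_f.
Qed.

(** Generators of es_t T es_0 for t <= n are extended to t = n + 1: by [gen_span_top] a word from n
    + 1 either ends at once or steps to an index r <= n, and the first factor from D is a
    combination of the [e i]. *)
Lemma finitely_generated : exists ws : seq B,
  (forall w : B, w \in ws -> gen w) /\ forall x, gen x -> rspan ws (x * es ord0).
Proof.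
suff fg n : exists ws : seq B, (forall w : B, w \in ws -> gen w) /\
    forall t x, (t < n.+1)%N -> gen x -> rspan ws (es t * x * es ord0).
  have [ws [gws H]] := fg d; exists ws; split=> // x gx.
  rewrite -[x]mul1r -(T_idem1 HTd) !mulr_suml.
  by apply: (lc_sum (rspan_lin_closed _)) => t _; apply: H.
elim: n => [|n [ws [gws IH]]].
  exists [:: es ord0]; split=> [w|t x t1 gx].
    by rewrite inE => /eqP ->; apply: gen_es.
  have -> : t = ord0 by apply: val_inj => /=; lia.
  rewrite -[X in X * x]esK -!mulrA [es ord0 * (x * _)]mulrA.
  by apply: rspanM => //; rewrite inE.
case: (ltnP n.+1 d.+1) => nd; last first.
  by exists ws; split=> // t x _; apply: IH; have := ltn_ord t; lia.
pose t0 := Ordinal nd.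
exists (ws ++ [seq es t0 * e i * w | i <- enum 'I_d.+1, w <- ws]); split.
  move=> w; rewrite mem_cat => /orP[/gws //|/allpairsP[[i v] /= [_ /gws gv ->]]].
  exact: genM (genM (gen_es _) (gen_e _)) gv.
have sub_l y : rspan ws y ->
    rspan (ws ++ [seq es t0 * e i * w | i <- enum 'I_d.+1, w <- ws]) y.
  rewrite -{2}[y]mul1r; apply: rspan_mull => z /mapP[w ww ->].
  by rewrite mul1r mem_cat ww.
have sub_r p y : rspan ws y ->
    rspan (ws ++ [seq es t0 * e i * w | i <- enum 'I_d.+1, w <- ws])
      (es t0 * pa p * y).
  move=> Hy; rewrite (horner_algE (T_idemM HT) (T_idem1 HT) (T_aE HT)).
  rewrite mulr_sumr mulr_suml; apply: (lc_sum (rspan_lin_closed _)) => i _.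
  rewrite -scalerAr -scalerAl; apply: (lcZ (rspan_lin_closed _)).
  apply: rspan_mull Hy => z /mapP[w ww ->]; rewrite mem_cat; apply/orP; right.
  by apply/allpairsP; exists (i, w); rewrite mem_enum.
move=> t x; rewrite ltnS leq_eqVlt => /orP[/eqP tn|lt] gx; last exact/sub_l/IH.
have -> : t = t0 by apply: val_inj.
suff H r y : span n.+1 ord0 r y -> r = t0 ->
    rspan (ws ++ [seq es t0 * e i * w | i <- enum 'I_d.+1, w <- ws]) y.
  by apply: (H t0 _ _ erefl); apply: (@gen_span_top ord0 t0 x isT gx).
elim=> {r y} [r p ->|r c y z _ Hy _ Hz r0|r r' p y r'n Hy _ ->].
- by apply: sub_r; have := IH ord0 1 isT (gen1 _ _); rewrite mulr1 esK.
- by apply: (proj2 (rspan_lin_closed _)); [apply: Hy|apply: Hz].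
apply: sub_r; rewrite -(span_esl Hy) -(span_esr Hy) mulrA; apply: IH => //.
exact: span_gen Hy.
Qed.

End Paths.

(** * The homomorphism mu *)

Section CommutingMmap.
Variables (F : fieldType) (n : nat) (B : algType F) (h : 'I_n -> B).
Local Notation ev := (mmap (in_alg B) h).

Lemma mmap1_comm x m : (forall i, GRing.comm x (h i)) -> GRing.comm x (mmap1 h m).
Proof. by move=> H; apply: GRing.commr_prod => i _; apply: commrX. Qed.

Lemma mmap_comm x p : (forall i, GRing.comm x (h i)) -> GRing.comm x (ev p).
Proof.
move=> H; apply: commr_sum => m _; apply: commrM; last exact: mmap1_comm.
by rewrite /GRing.comm mulr_algr mulr_algl.
Qed.

Lemma mmap_linP c p q : ev (c *: p + q) = c *: ev p + ev q.
Proof. by rewrite mmapD mmapZ /= mulr_algl. Qed.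

Hypothesis hC : forall i j, GRing.comm (h i) (h j).

Lemma mmap1_commM m1 m2 : mmap1 h (m1 + m2) = mmap1 h m1 * mmap1 h m2.
Proof.
pose G i := h i ^+ m1 i * h i ^+ m2 i.
rewrite /mmap1 (eq_bigr G) => [|i _]; last by rewrite mnmDE exprD.
(* The induction also carries that the partial product commutes with every [h i], as [B] is not
   commutative. *)
pose C x := forall i, GRing.comm (h i) x.
suff [_ ->] : C (\prod_(i < n) h i ^+ m1 i) /\ \prod_i G i =
  (\prod_(i < n) h i ^+ m1 i) * (\prod_(i < n) h i ^+ m2 i) by [].
elim/big_rec3: _ => [|i y1 y2 y3 _ [Cy ->]].
  by split; [move=> i; apply: commr1 | rewrite mulr1].
split=> [j|]; first by apply: commrM; [apply/commrX/hC|apply: Cy].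
rewrite /G -!mulrA; congr (_ * _); rewrite !mulrA; congr (_ * _).
by apply/commr_sym/commrX/commr_sym.
Qed.

Lemma mmap_commM p q : ev (p * q) = ev p * ev q.
Proof.
have X m r : ev ('X_[m] * r) = mmap1 h m * ev r.
  rewrite {1}[r]mpolyE mulr_sumr raddf_sum /= [in RHS]/mmap mulr_sumr.
  apply: eq_bigr => m' _; rewrite -scalerAr -mpolyXD mmapZ mmapX mmap1_commM.
  by rewrite /= mulr_algl mulr_algl scalerAr.
rewrite {1}[p]mpolyE mulr_suml raddf_sum /= [in RHS]/mmap mulr_suml.
by apply: eq_bigr => m _; rewrite -scalerAl mmapZ X mulrA.
Qed.

End CommutingMmap.

Section Mu.
Variables (F : fieldType) (d : nat) (th ths : nat -> F) (B : algType F).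
Variables (a : B) (e : 'I_d.+1 -> B) (as_ : B) (es : 'I_d.+1 -> B).
Hypothesis HT : T_relations th ths a e as_ es.
Hypothesis HC1 : C1 d th ths.
Let HTd := T_relations_dual HT.
Local Notation es0 := (es ord0).
Local Notation gen := (gen_alg a as_).
Local Notation mu := (@mu_eval F d th B a es0).
Implicit Types p q : {mpoly F[d]}.

Let h (k : 'I_d) := es0 * tau_alg th k.+1 a * es0.

Let es0K : es0 * es0 = es0. Proof. exact: (esK HT). Qed.

Let es0_h k : GRing.comm es0 (h k).
Proof. by rewrite /GRing.comm /h !mulrA es0K -[in RHS]mulrA es0K. Qed.

Let hC j k : GRing.comm (h j) (h k).
Proof.
have es0E := idem_poly (T_idemM HTd) (T_idem1 HTd) (T_aE HTd) (proj2 HC1) ord0.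
have X (p q : {poly F}) : es0 * horner_alg a p * es0 * (es0 * horner_alg a q * es0) =
    es0 * horner_alg a p * es0 * horner_alg a q * es0.
  by rewrite !mulrA -[_ * es0 * es0]mulrA es0K.
rewrite /GRing.comm /h !(tau_algE th) !X.
(* The Lagrange polynomial of node 0 makes the middle factor w(as_) equal to [es0]. *)
by have := es0_symmetric HT HC1 (node_prod th 0 j.+1) (node_prod th 0 k.+1)
  (lagrange_node ths (@ord0 d)); rewrite -es0E.
Qed.

Let muE p : mu p = es0 * mmap (in_alg B) h p * es0. Proof. by []. Qed.

Lemma muP c p q : mu (c *: p + q) = c *: mu p + mu q.
Proof.
by rewrite !muE mmap_linP mulrDr mulrDl -scalerAr -scalerAl.
Qed.

Lemma mu1 : mu 1 = es0.
Proof. by rewrite muE -mpolyC1 mmapC /= scale1r mulr1 es0K. Qed.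

Lemma muX k : mu 'X_k = es0 * tau_alg th k.+1 a * es0.
Proof. by rewrite muE mmapX mmap1U /h !mulrA es0K -mulrA es0K. Qed.

Lemma muM p q : mu (p * q) = mu p * mu q.
Proof.
rewrite !muE mmap_commM // -!mulrA; congr (_ * (_ * _)).
by rewrite !mulrA es0K (mmap_comm q es0_h) -mulrA es0K.
Qed.

Lemma mu_surj x : gen x -> exists p, es0 * x * es0 = mu p.
Proof.
pose S y := exists p, y = mu p.
have HS : lin_closed S.
  split=> [|c _ _ [p ->] [q ->]]; last by exists (c *: p + q); rewrite muP.
  by exists 0; rewrite muE mmap0 mulr0 mul0r.
have S1 (p : {poly F}) : S (es0 * horner_alg a p * es0).
  apply: (horner_alg_tau_ind HT (S := fun y => S (es0 * y * es0))).
    split=> [|c y z Sy Sz]; first by rewrite mulr0 mul0r; apply: lc0.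
    by rewrite mulrDr mulrDl -scalerAr -scalerAl; apply: (proj2 HS).
  case=> [|k] lk; first by exists 1; rewrite /tau_alg big_ord0 mulr1 es0K mu1.
  by exists 'X_(Ordinal lk); rewrite muX.
apply: (es0_gen_ind HT HC1 HS) => // p y [q ->].
by have [r ->] := S1 p; exists (r * q); rewrite muM.
Qed.

End Mu.

(** * A faithful model *)

(** Classical: a row space inside S either exhausts S or can be enlarged by a vector of S, and its
    rank cannot exceed N. *)
Lemma lin_closed_matrix (F : fieldType) (N : nat) (S : 'rV[F]_N -> Prop) :
  lin_closed S -> exists W : 'M[F]_N, forall v, S v <-> (v <= W)%MS.
Proof.
move=> HS; pose good (W : 'M[F]_N) := forall v : 'rV_N, (v <= W)%MS -> S v.
have step k : (exists W : 'M[F]_N, forall v, S v <-> (v <= W)%MS) \/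
    exists2 W, good W & (k <= \rank W)%N.
  elim: k => [|k [|[W gW kW]]]; first by right; exists 0 => // v;
    rewrite submx0 => /eqP ->; apply: lc0.
    by left.
  have [H|] := boolp.EM (forall v, S v -> (v <= W)%MS).
    by left; exists W => v; split; [apply: H|apply: gW].
  move=> /boolp.existsNP[v /boolp.not_implyP[Sv vW]]; right.
  exists (W + v)%MS.
    move=> u /sub_addsmxP[[x y] /= ->]; apply: (lcD HS).
      exact/gW/submxMl.
    by rewrite [y]mx11_scalar mul_scalar_mx; apply: lcZ.
  apply: leq_ltn_trans kW (rank_ltmx _).
  rewrite ltmxE addsmxSl /=; apply: contra_notN vW => H.
  exact: submx_trans (addsmxSr _ _) H.
case: (step N.+1) => // [[W _]]; by rewrite ltnNge rank_leq_row.
Qed.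

(* [i0] only witnesses that the product is a nonzero ring. *)
Definition prod_alg (F : fieldType) (I : Type) (i0 : I) (B : I -> algType F) :=
  forall i, B i.

Section ProdAlg.
Variables (F : fieldType) (I : Type) (i0 : I) (B : I -> algType F).
Local Notation P := (prod_alg i0 B).
Implicit Types x y z : P.

Let ext x y : (forall i, x i = y i) -> x = y.
Proof. exact: boolp.functional_extensionality_dep. Qed.

HB.instance Definition _ := boolp.gen_eqMixin P.
HB.instance Definition _ := boolp.gen_choiceMixin P.

Definition prod_add x y : P := fun i => x i + y i.
Definition prod_opp x : P := fun i => - x i.
Definition prod_zero : P := fun i => 0.
Definition prod_mul x y : P := fun i => x i * y i.
Definition prod_one : P := fun i => 1.
Definition prod_scale (c : F) x : P := fun i => c *: x i.

Fact prod_addA : associative prod_add.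
Proof. by move=> x y z; apply: ext => i; apply: addrA. Qed.
Fact prod_addC : commutative prod_add.
Proof. by move=> x y; apply: ext => i; apply: addrC. Qed.
Fact prod_add0 : left_id prod_zero prod_add.
Proof. by move=> x; apply: ext => i; apply: add0r. Qed.
Fact prod_addN : left_inverse prod_zero prod_opp prod_add.
Proof. by move=> x; apply: ext => i; apply: addNr. Qed.
HB.instance Definition _ :=
  GRing.isZmodule.Build P prod_addA prod_addC prod_add0 prod_addN.

Fact prod_mulA : associative prod_mul.
Proof. by move=> x y z; apply: ext => i; apply: mulrA. Qed.
Fact prod_mul1l : left_id prod_one prod_mul.
Proof. by move=> x; apply: ext => i; apply: mul1r. Qed.
Fact prod_mul1r : right_id prod_one prod_mul.
Proof. by move=> x; apply: ext => i; apply: mulr1. Qed.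
Fact prod_mulDl : left_distributive prod_mul prod_add.
Proof. by move=> x y z; apply: ext => i; apply: mulrDl. Qed.
Fact prod_mulDr : right_distributive prod_mul prod_add.
Proof. by move=> x y z; apply: ext => i; apply: mulrDr. Qed.
Fact prod_one_neq0 : prod_one != (0 : P).
Proof.
apply/eqP => /(congr1 (fun x : P => x i0)) => H.
by have /eqP := oner_neq0 (B i0); apply.
Qed.
HB.instance Definition _ := GRing.Zmodule_isNzRing.Build P
  prod_mulA prod_mul1l prod_mul1r prod_mulDl prod_mulDr prod_one_neq0.

Fact prod_scaleA c c' x : prod_scale c (prod_scale c' x) = prod_scale (c * c') x.
Proof. by apply: ext => i; apply: scalerA. Qed.
Fact prod_scale1 : left_id 1 prod_scale.
Proof. by move=> x; apply: ext => i; apply: scale1r. Qed.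
Fact prod_scaleDr : right_distributive prod_scale prod_add.
Proof. by move=> c x y; apply: ext => i; apply: scalerDr. Qed.
Fact prod_scaleDl x : {morph prod_scale^~ x : c c' / c + c'}.
Proof. by move=> c c'; apply: ext => i; apply: scalerDl. Qed.
HB.instance Definition _ := GRing.Zmodule_isLmodule.Build F P
  prod_scaleA prod_scale1 prod_scaleDr prod_scaleDl.

Fact prod_scaleAl c x y : c *: (x * y) = (c *: x) * y.
Proof. by apply: ext => i; apply: scalerAl. Qed.
HB.instance Definition _ := GRing.Lmodule_isLalgebra.Build F P prod_scaleAl.
Fact prod_scaleAr c x y : c *: (x * y) = x * (c *: y).
Proof. by apply: ext => i; apply: scalerAr. Qed.
HB.instance Definition _ := GRing.Lalgebra_isAlgebra.Build F P prod_scaleAr.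

Lemma prod_algP x y : (forall i, x i = y i) -> x = y. Proof. exact: ext. Qed.
Lemma prod_algD x y i : (x + y) i = x i + y i. Proof. by []. Qed.
Lemma prod_algM x y i : (x * y) i = x i * y i. Proof. by []. Qed.
Lemma prod_alg0 i : (0 : P) i = 0. Proof. by []. Qed.
Lemma prod_alg_sum (J : Type) (r : seq J) (Q : pred J) (f : J -> P) i :
  (\sum_(j <- r | Q j) f j) i = \sum_(j <- r | Q j) f j i.
Proof. by apply: (big_morph (fun x : P => x i)) => // x y; apply: prod_algD. Qed.
Lemma prod_alg_prod (J : Type) (r : seq J) (Q : pred J) (f : J -> P) i :
  (\prod_(j <- r | Q j) f j) i = \prod_(j <- r | Q j) f j i.
Proof. by apply: (big_morph (fun x : P => x i)) => // x y; apply: prod_algM. Qed.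
Lemma prod_algX x k i : (x ^+ k) i = x i ^+ k.
Proof. by elim: k => [|k IH]; rewrite ?expr0 // !exprS prod_algM IH. Qed.

End ProdAlg.

Section FaithfulModel.
Variables (F : fieldType) (d : nat) (th ths : nat -> F).

Record T_model := TModel {
  tm_alg : algType F;
  tm_a : tm_alg; tm_e : 'I_d.+1 -> tm_alg;
  tm_as : tm_alg; tm_es : 'I_d.+1 -> tm_alg;
  tm_rel : T_relations th ths tm_a tm_e tm_as tm_es }.

(** For each nonzero p choose a model in which mu(p) is nonzero. In the product of the chosen models
    mu(p) has a nonzero component for every such p. *)
Lemma mu_faithful : mu_injective d th ths ->
  exists (B : algType F) (a : B) (e : 'I_d.+1 -> B) (as_ : B) (es : 'I_d.+1 -> B),
    T_relations th ths a e as_ es /\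
    forall p : {mpoly F[d]}, mu_eval th a (es ord0) p = 0 -> p = 0.
Proof.
move=> Hmu.
have ex (p : {p : {mpoly F[d]} | p <> 0}) :
    exists M : T_model, mu_eval th (tm_a M) (tm_es M ord0) (sval p) <> 0.
  case: p => p p0 /=; apply: boolp.contrapT => H; apply: p0; apply: Hmu.
  move=> B a e as_ es HT; apply: boolp.contrapT => H0; apply: H.
  by exists (TModel HT).
have [M HM] := boolp.choice ex.
have i0 : {p : {mpoly F[d]} | p <> 0} by exists 1; apply/eqP; apply: oner_neq0.
pose B : algType F := prod_alg i0 (fun p => tm_alg (M p)).
exists B, (fun p => tm_a (M p)), (fun i p => tm_e (M p) i),
  (fun p => tm_as (M p)), (fun i p => tm_es (M p) i); split.
  split.
  - move=> i j; apply: prod_algP => p; rewrite prod_algM.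
    by case: (tm_rel (M p)) => -> *; case: eqP.
  - move=> i j; apply: prod_algP => p; rewrite prod_algM.
    by case: (tm_rel (M p)) => _ -> *; case: eqP.
  - by split; apply: prod_algP => p; rewrite prod_alg_sum;
      case: (tm_rel (M p)) => _ _ [].
  - by split; apply: prod_algP => p; rewrite prod_alg_sum;
      case: (tm_rel (M p)) => _ _ _ [].
  move=> i j k kd kij; split; apply: prod_algP => p; rewrite !prod_algM prod_algX;
    by case: (tm_rel (M p)) => _ _ _ _ /(_ i j k kd kij)[].
move=> p mu0; apply: boolp.contrapT => p0; apply: (HM (exist _ p p0)) => /=.
have /(congr1 (fun x : B => x (exist _ p p0))) := mu0.
rewrite prod_alg0 => H0; rewrite -[RHS]H0.
rewrite /mu_eval !prod_algM; congr (_ * _ * _).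
rewrite /mmap prod_alg_sum; apply: eq_bigr => m _.
rewrite prod_algM; congr (_ * _).
rewrite /mmap1 prod_alg_prod; apply: eq_bigr => k _.
rewrite prod_algX !prod_algM; congr ((_ * _ * _) ^+ _).
by rewrite /tau_alg prod_alg_prod.
Qed.
End FaithfulModel.

(** * The module of a character *)

Section QuotientModule.
Variables (F : fieldType) (B : algType F) (a as_ : B) (chi : B -> F) (ws : seq B).
Local Notation gen := (gen_alg a as_).
Hypothesis chiP : forall c x y, gen x -> gen y -> chi (c *: x + y) = c * chi x + chi y.
Hypothesis chi1 : chi 1 != 0.
Hypothesis gen_ws : forall w, w \in ws -> gen w.
Hypothesis ws_radical : forall f, gen f ->
  (forall w, w \in ws -> chi (f * w) = 0) -> forall g, gen g -> chi (f * g) = 0.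

Let chi0 : chi 0 = 0.
Proof.
have := chiP (-1) (gen1 a as_) (gen1 a as_).
by rewrite scaleN1r addNr mulN1r addNr.
Qed.

(** The right module gen / R, where R is the right ideal of all f with chi (f * g) = 0 for every g.
    Testing against the finite list [ws] suffices by [ws_radical], so [r] embeds the quotient in a
    finite-dimensional row space; [pi] is the class map in coordinates and [rho] the right
    action. *)
Lemma quotient_module : exists (n : nat) (rho : B -> 'M[F]_n.+1) (pi : B -> 'rV[F]_n.+1),
  [/\ rho 1 = 1 /\
        forall c x y, gen x -> gen y -> rho (c *: x + y) = c *: rho x + rho y,
      forall x y, gen x -> gen y -> rho (x * y) = rho x * rho y,
      (forall c x y, gen x -> gen y -> pi (c *: x + y) = c *: pi x + pi y) /\
        forall x y, gen x -> gen y -> pi (x * y) = pi x *m rho y,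
      forall v, exists2 x, gen x & v = pi x &
      forall x, gen x -> pi x = 0 <-> forall g, gen g -> chi (x * g) = 0].
Proof.
pose r x : 'rV[F]_(size ws) := \row_i chi (x * ws`_i).
have rP c x y : gen x -> gen y -> r (c *: x + y) = c *: r x + r y.
  move=> gx gy; apply/rowP => i; rewrite !mxE mulrDl -scalerAl chiP //;
    by apply: genM => //; apply/gen_ws/mem_nth.
have r0P x : gen x -> r x = 0 <-> forall g, gen g -> chi (x * g) = 0.
  move=> gx; split=> [/rowP r0|H].
    apply: ws_radical => // w /(nthP 0)[i lti <-].
    by have := r0 (Ordinal lti); rewrite !mxE.
  by apply/rowP => i; rewrite !mxE; apply/H/gen_ws/mem_nth.
have [W HW] : exists W : 'M[F]_(size ws),
    forall v, (exists2 x, gen x & v = r x) <-> (v <= W)%MS.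
  apply: lin_closed_matrix; split.
    exists 0; first exact: (lc0 (gen_lin_closed _ _)).
    by apply/rowP => i; rewrite !mxE mul0r chi0.
  move=> c _ _ [x gx ->] [y gy ->]; exists (c *: x + y); first exact: genP.
  by rewrite rP.
have rW x : gen x -> (r x <= W)%MS by move=> gx; apply/HW; exists x.
have r1 : r 1 != 0.
  apply: contraNneq chi1 => /(r0P _ (gen1 _ _)) /(_ _ (gen1 _ _)).
  by rewrite mulr1 => ->.
have [n nW] : exists n, \rank W = n.+1.
  exists (\rank W).-1; rewrite prednK // lt0n; apply: contra_neq r1 => /eqP.
  rewrite mxrank_eq0 => /eqP W0; apply/eqP; rewrite -submx0 -W0.
  exact/rW/gen1.
move: (row_base W) (eq_row_base W) (row_base_free W); rewrite nW => b bW b_free.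
have {}HW v : (exists2 x, gen x & v = r x) <-> (v <= b)%MS by rewrite bW.
have {}rW x : gen x -> (r x <= b)%MS by rewrite bW; apply: rW.
(* Coordinates in the basis [b] of the image of [r]. *)
pose pi x : 'rV[F]_n.+1 := r x *m pinvmx b.
have pib x : gen x -> pi x *m b = r x by move/rW/mulmxKpV.
have b_inj (u v : 'rV[F]_n.+1) : u *m b = v *m b -> u = v.
  exact: row_free_inj.
have [f Hf] : exists f : 'I_n.+1 -> B, forall i, gen (f i) /\ r (f i) = row i b.
  suff ex i : exists x, gen x /\ r x = row i b by apply: fin_all_exists ex.
  by have /HW[x gx E] := row_sub i b; exists x.
have gf i : gen (f i) by case: (Hf i).
have rf i : r (f i) = row i b by case: (Hf i).
have piP c x y : gen x -> gen y -> pi (c *: x + y) = c *: pi x + pi y.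
  by move=> gx gy; rewrite /pi rP // mulmxDl scalemxAl.
have pi0 x : gen x -> pi x = 0 <-> r x = 0.
  move=> gx; split=> [p0|r0]; first by rewrite -pib // p0 mul0mx.
  by rewrite /pi r0 mul0mx.
(* Right multiplication by y, computed on the lifts [f i] of the basis. *)
pose rho y : 'M[F]_n.+1 := \matrix_i pi (f i * y).
have gsum (c : 'I_n.+1 -> F) : gen (\sum_i c i *: f i).
  apply: (lc_sum (gen_lin_closed _ _)) => i _.
  exact: (lcZ (gen_lin_closed _ _)).
have pi_sum (c : 'I_n.+1 -> F) y : gen y ->
    pi ((\sum_i c i *: f i) * y) = \sum_i c i *: pi (f i * y).
  move=> gy; rewrite mulr_suml.
  suff [_ ->] : gen (\sum_i (c i *: f i) * y) /\
    pi (\sum_i (c i *: f i) * y) = \sum_i c i *: pi (f i * y) by [].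
  have g0 : gen 0 by apply: (lc0 (gen_lin_closed _ _)).
  have pi00 : pi 0 = 0 by apply/pi0=> //; apply/r0P => // g _; rewrite mul0r chi0.
  elim/big_rec2: _ => [//|i u v _ [gv E]]; rewrite -scalerAl; split.
    by apply: genP => //; apply: genM.
  by rewrite piP ?E //; apply: genM.
have piM x y : gen x -> gen y -> pi (x * y) = pi x *m rho y.
  move=> gx gy; rewrite mulmx_sum_row.
  under eq_bigr do rewrite rowK.
  rewrite -pi_sum //; set z := \sum_i _; have gz : gen z by apply: gsum.
  have E : r x = r z.
    rewrite -(pib x) // mulmx_sum_row.
    have := pi_sum (pi x 0) 1 (gen1 _ _); rewrite mulr1 -/z => /(congr1 (mulmx^~ b)).
    rewrite pib // => ->; rewrite mulmx_suml; apply: eq_bigr => i _.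
    by rewrite mulr1 -scalemxAl pib // rf.
  (* x - z lies in the radical, a right ideal, so x * y and z * y have the same class. *)
  have gxz : gen ((-1) *: z + x) by apply: genP.
  have : r ((-1) *: z + x) = 0 by rewrite rP // E scaleN1r addNr.
  move/(r0P _ gxz) => H.
  have : pi ((-1) *: (z * y) + x * y) = 0.
    rewrite scalerAl -mulrDl; apply/pi0; first exact: genM.
    by apply/r0P; [apply: genM|move=> g gg; rewrite -mulrA; apply/H/genM].
  by rewrite piP; [|apply: genM|apply: genM] => // /eqP;
    rewrite scaleN1r addrC subr_eq0 => /eqP.
exists n, rho, pi; split=> //.
- split=> [|c x y gx gy]; apply/row_matrixP => i; rewrite ?linearP /= !rowK.
    apply: b_inj; rewrite mulr1 pib // rf row1 -rowE //.
  by rewrite mulrDr -scalerAr piP //; apply: genM.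
- move=> x y gx gy; apply/row_matrixP => i.
  by rewrite row_mul !rowK mulrA piM //; apply: genM.
- move=> v; have /HW[x gx E] : (v *m b <= b)%MS by apply: submxMl.
  by exists x => //; apply: b_inj; rewrite pib.
by move=> x gx; rewrite pi0 //; apply: r0P.
Qed.

End QuotientModule.

(** * Tridiagonal systems *)

(** The band relations only involve |i - j|, so the order of the [e i] may be reversed. This carries
    statements about E_0 over to E_d. *)
Lemma T_relations_rev (F : fieldType) (d : nat) (th ths : nat -> F) (B : algType F)
    (a : B) (e : 'I_d.+1 -> B) (as_ : B) (es : 'I_d.+1 -> B) :
  T_relations th ths a e as_ es ->
  T_relations (fun i => th (d - i)%N) ths a (fun i => e (rev_ord i)) as_ es.
Proof.
have big_rev (f : 'I_d.+1 -> B) : \sum_i f (rev_ord i) = \sum_i f i.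
  by rewrite [RHS](reindex_inj rev_ord_inj).
case=> H1 H2 [H3 H4] [H5 H6] H7; split=> //.
- by move=> i j; rewrite H1 (inj_eq rev_ord_inj).
- by rewrite big_rev.
- split=> //; rewrite H5 -[LHS]big_rev; apply: eq_bigr => i _ /=.
  by rewrite subSS.
move=> i j k kd kij; split; first by case: (H7 i j k kd kij).
have [|_ ->] // := H7 (rev_ord i) (rev_ord j) k kd.
by move: kij (ltn_ord i) (ltn_ord j) => /=; lia.
Qed.

Lemma natr_bool_neq0 (F : fieldType) (b : bool) : (b%:R != 0 :> F) = b.
Proof. by case: b; rewrite ?oner_neq0 ?eqxx. Qed.

Section Diag.
Variables (F : fieldType) (d : nat) (th ths : nat -> F) (B : algType F).
Variables (a : B) (e : 'I_d.+1 -> B) (as_ : B) (es : 'I_d.+1 -> B).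
Hypothesis HT : T_relations th ths a e as_ es.
Let HTd := T_relations_dual HT.

Definition diag_el (f : 'I_d.+1 -> B) (c : nat -> F) := \sum_(i < d.+1) c i *: f i.

Lemma idem_diag c i : e i * diag_el e c = c i *: e i.
Proof. exact: (idem_sumM (T_idemM HT)). Qed.

Lemma diag_idem c i : diag_el e c * e i = c i *: e i.
Proof. exact: (sum_idemM (T_idemM HT)). Qed.

Lemma diag_elM c c' : diag_el e c * diag_el e c' = diag_el e (fun i => c i * c' i).
Proof.
apply: (idem_ext (T_idem1 HT)) => i.
by rewrite mulrA idem_diag -scalerAl !idem_diag scalerA.
Qed.

Lemma eq_diag_el c c' : (forall i, (i <= d)%N -> c i = c' i) ->
  diag_el e c = diag_el e c'.
Proof. by move=> H; apply: eq_bigr => i _; rewrite H // -ltnS. Qed.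

Lemma a_subE c : a - c%:A = diag_el e (fun i => th i - c).
Proof.
apply: (idem_ext (T_idem1 HT)) => i; rewrite idem_diag mulrBr.
by rewrite (idem_a (T_idemM HT) (T_aE HT)) scalerBl mulr_algr.
Qed.

Lemma T_tridiag (i j : 'I_d.+1) : (1 < maxn i j - minn i j)%N -> e i * as_ * e j = 0.
Proof.
move=> lt; have := T_band HT (w := 'X) (i := i) (j := j).
by rewrite horner_algX size_polyX; apply.
Qed.

(** [as_] moves an index by at most 1, so a right factor equal to 1 on all neighbours of the support
    of c changes nothing. *)
Lemma diag_tridiag (c c' : nat -> F) :
  (forall i j : 'I_d.+1, (maxn i j - minn i j <= 1)%N -> c i != 0 -> c' j = 1) ->
  diag_el e c * as_ * diag_el e c' = diag_el e c * as_.
Proof.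
move=> H; apply: (idem_ext2 (T_idem1 HT)) => i j.
rewrite !mulrA idem_diag -!scalerAl -!mulrA diag_idem -!scalerAr.
have [->|ci] := eqVneq (c i) 0; first by rewrite !scale0r.
case: (ltnP 1 (maxn i j - minn i j)) => lt.
  by rewrite !mulrA T_tridiag // !scaler0.
by rewrite (H i j) // scale1r.
Qed.
End Diag.

Section Irreducible.
Variables (F : fieldType) (n : nat).
Implicit Types (d : nat) (th ths : nat -> F).
Local Notation M := 'M[F]_n.+1.

Definition irreducible_pair (A As : M) := forall W : M,
  (W *m A <= W)%MS -> (W *m As <= W)%MS -> \rank W = 0%N \/ \rank W = n.+1.

Lemma irreducible_pairC A As : irreducible_pair A As -> irreducible_pair As A.
Proof. by move=> H W HA HAs; apply: H. Qed.

(* The sum over [i < d] of (Es_0 V + ... + Es_i V) :&: (E_(i+1) V + ... + E_d V)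
   is invariant and is killed by [Es_d], hence it vanishes. *)
Lemma split_injective d th ths (A As : M) (E Es : 'I_d.+1 -> M) :
  T_relations th ths A E As Es -> irreducible_pair A As -> Es ord_max != 0 ->
  forall v : 'rV_n.+1, v *m Es ord0 = v -> v *m E ord0 = 0 -> v = 0.
Proof.
move=> HT irr Esd v vs v0; have HTd := T_relations_dual HT.
pose P i : M := diag_el Es (fun j => (j <= i)%N%:R).
pose Q i : M := diag_el E (fun j => (i < j)%N%:R).
pose W : M := (\sum_(i < d) (P i :&: Q i)%MS)%MS.
have PP i : P i *m P i = P i.
  rewrite [LHS](diag_elM HTd); apply: eq_diag_el => j _.
  by rewrite -natrM mulnb andbb.
have QQ i : Q i *m Q i = Q i.
  rewrite [LHS](diag_elM HT); apply: eq_diag_el => j _.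
  by rewrite -natrM mulnb andbb.
have memP i (u : 'rV_n.+1) : (u <= P i :&: Q i)%MS <-> u *m P i = u /\ u *m Q i = u.
  rewrite sub_capmx; split=> [/andP[/submxP[x ux] /submxP[y uy]]|[uP uQ]].
    by split; [rewrite ux -mulmxA PP|rewrite uy -mulmxA QQ].
  by rewrite -{1}uP submxMl -uQ submxMl.
have PA i : P i *m A *m P i.+1 = P i *m A.
  apply: (diag_tridiag HTd) => k l lkl; rewrite natr_bool_neq0 => lki.
  by rewrite (_ : (l <= i.+1)%N) //; lia.
have QAs i : Q i.+1 *m As *m Q i = Q i.+1 *m As.
  apply: (diag_tridiag HT) => k l lkl; rewrite natr_bool_neq0 => lki.
  by rewrite (_ : (i < l)%N) //; lia.
have memW i (u : 'rV_n.+1) : (i < d)%N -> u *m P i = u -> u *m Q i = u -> (u <= W)%MS.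
  move=> lid uP uQ; apply: (sumsmx_sup (Ordinal lid)) => //.
  by apply/memP.
have mulc (u : 'rV[F]_n.+1) c : u *m (c%:A : M) = c *: u.
  by rewrite -scalemxAr mulmx1.
have addc (u : 'rV_n.+1) X (c : F) : (u <= W)%MS -> (u *m (X - c%:A) <= W)%MS ->
    (u *m X <= W)%MS.
  move=> uW; rewrite mulmxBr mulc => H.
  by rewrite -(subrK (c *: u) (u *m X)) addmx_sub // scalemx_sub.
have WA : (W *m A <= W)%MS.
  rewrite sumsmxMr; apply/sumsmx_subP => i _; apply/rV_subP => u /submxP[x ->].
  rewrite mulmxA; set w := x *m _.
  have /memP[wP wQ] : (w <= P i :&: Q i)%MS by apply: submxMl.
  apply: (addc _ _ (th i.+1)); first by apply: memW wQ; rewrite ?wP.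
  (* A - th_(i+1) removes the component in E_(i+1), so it maps Q i into Q (i+1); since A maps P i
     into P (i+1), the i-th summand goes into the next one, or to 0 when i + 1 = d. *)
  have E1 : Q i *m (A - (th i.+1)%:A) *m Q i.+1 = Q i *m (A - (th i.+1)%:A).
    rewrite (a_subE HT) [X in X *m _](diag_elM HT) [LHS](diag_elM HT).
    rewrite [RHS](diag_elM HT); apply: eq_diag_el => j _.
    by case: (ltngtP i.+1 j) => [_|_|->]; rewrite ?subrr ?mulr1 ?mulr0 ?mul0r.
  case: (ltnP i.+1 d) => lid.
    apply: memW lid _ _; last by rewrite -wQ -!mulmxA [Q i *m _]mulmxA E1.
    have wP' : w *m P i.+1 = w.
      rewrite -wP -mulmxA [X in _ *m X](diag_elM HTd); congr (_ *m _).
      apply: eq_diag_el => j _.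
      by case: (leqP j i) => ji; rewrite ?mul0r // mul1r (leqW ji).
    rewrite mulmxBr mulc mulmxBl -scalemxAl wP'; congr (_ - _).
    by rewrite -wP -!mulmxA [P i *m _]mulmxA PA.
  rewrite -wQ -mulmxA -E1.
  have -> : Q i.+1 = 0.
    rewrite /Q /diag_el big1 // => j _; rewrite ltnNge.
    by rewrite (leq_trans _ lid) ?scale0r // -ltnS.
  by rewrite !mulmx0 sub0mx.
have WAs : (W *m As <= W)%MS.
  rewrite sumsmxMr; apply/sumsmx_subP => -[i lid] _; apply/rV_subP => u /submxP[x ->].
  rewrite mulmxA; set w := x *m _ => /=.
  have /memP[wP wQ] : (w <= P i :&: Q i)%MS by apply: submxMl.
  apply: (addc _ _ (ths i)); first exact: memW lid wP wQ.
  (* Dually, As - ths_i maps the i-th summand into the previous one, and to 0 when i = 0. *)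
  case: i lid @w wP wQ => [|i] lid w wP wQ.
    rewrite -wP -mulmxA (_ : P 0%N *m _ = 0) ?mulmx0 ?sub0mx //.
    rewrite (a_subE HTd) [LHS](diag_elM HTd) /diag_el big1 // => j _.
    by case: j => [[|j] ?]; rewrite /= ?subrr ?mulr0 ?mul0r scale0r.
  have E1 : P i.+1 *m (As - (ths i.+1)%:A) *m P i = P i.+1 *m (As - (ths i.+1)%:A).
    rewrite (a_subE HTd) [X in X *m _](diag_elM HTd) [LHS](diag_elM HTd).
    rewrite [RHS](diag_elM HTd); apply: eq_diag_el => j _.
    rewrite -[(j <= i)%N]ltnS.
    by case: (ltngtP j i.+1) => [_|_|->]; rewrite ?subrr ?mulr1 ?mulr0 ?mul0r.
  apply: (memW i); first exact: ltnW.
    by rewrite -wP -!mulmxA [P _ *m _]mulmxA E1.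
  have wQ' : w *m Q i = w.
    rewrite -wQ -mulmxA [X in _ *m X](diag_elM HT); congr (_ *m _).
    apply: eq_diag_el => j _.
    by case: (ltnP i.+1 j) => ji; rewrite ?mul0r // mul1r (ltnW ji).
  rewrite mulmxBr mulc mulmxBl -scalemxAl wQ'; congr (_ - _).
  by rewrite -wQ -!mulmxA [Q _ *m _]mulmxA QAs.
have W0 : W = 0.
  apply/eqP; rewrite -mxrank_eq0; case: (irr W WA WAs) => [-> //|fW].
  (* All summands have i < d, so Es_d annihilates W; a full W would force Es_d = 0. *)
  case/negP: Esd; rewrite -submx0.
  have W1 : (1%:M <= W)%MS by rewrite sub1mx /row_full fW.
  have : (1%:M *m Es ord_max <= W *m Es ord_max)%MS by apply: submxMr.
  rewrite mul1mx => /submx_trans; apply.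
  rewrite sumsmxMr; apply/sumsmx_subP => i _.
  apply: (submx_trans (submxMr _ (capmxSl _ _))).
  by rewrite [X in (X <= _)%MS](diag_idem HTd) /= leqNgt ltn_ord scale0r submx0.
(* For d = 0 the sum is empty and E_0 = 1. Otherwise v lies in the summand of index 0. *)
case: (posnP d) => [d0|d_gt0].
  have E1 : E ord0 = 1%:M.
    have := T_idem1 HT; rewrite big_ord_recl big1 ?addr0 // => i _.
    by exfalso; have := ltn_ord i; lia.
  by rewrite -[v]mulmx1 -E1.
apply/eqP; rewrite -submx0 -W0; apply: (memW 0%N) => //.
  rewrite -[v in LHS]vs -mulmxA (_ : _ *m _ = Es ord0) //.
  by rewrite [LHS](idem_diag HTd) scale1r.
have E1 : Q 0%N + E ord0 = 1.
  apply: (idem_ext (T_idem1 HT)) => i; rewrite mulrDr (idem_diag HT) mulr1.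
  rewrite (T_idemM HT); case: eqP => [->|/eqP ne]; first by rewrite scale0r add0r.
  by rewrite addr0 lt0n -val_eqE /= in ne *; rewrite ne scale1r.
by rewrite -[RHS]mulmx1 -[1%:M]/(1 : M) -E1 mulmxDr v0 addr0.
Qed.
End Irreducible.

Lemma tridiag_pow (F : fieldType) (d : nat) (B : algType F) (x : B)
    (e : 'I_d.+1 -> B) :
  (forall i j, e i * e j = if i == j then e i else 0) -> \sum_i e i = 1 ->
  (forall i j : 'I_d.+1, (1 < maxn i j - minn i j)%N -> e i * x * e j = 0) ->
  forall (k : nat) (i j : 'I_d.+1), (k < maxn i j - minn i j)%N ->
    e i * x ^+ k * e j = 0.
Proof.
move=> eM e1 H; elim=> [|k IH] i j lk.
  by rewrite mulr1 eM; case: eqP => // ij; move: lk; rewrite ij; lia.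
rewrite exprSr -[x ^+ k]mulr1 -e1 mulr_sumr !mulr_suml mulr_sumr mulr_suml.
apply: big1 => l _; case: (ltnP k (maxn i l - minn i l)) => lkl.
  by rewrite !mulrA IH ?mul0r.
by rewrite -!mulrA [e l * _]mulrA H ?mulr0 //; lia.
Qed.

(** * Standard orderings and primitive idempotents versus the relations of T *)

Section EigenData.
Variables (F : fieldType) (n d : nat).
Local Notation M := 'M[F]_n.+1.

Section FromEigen.
Variables (A : M) (t : 'I_d.+1 -> F) (E : 'I_d.+1 -> M) (th : nat -> F).
Hypotheses (Adiag : diagonalizable A) (At : eigen_ordering A t).
Hypotheses (EA : forall i, prim_idem A t i (E i)) (Eth : eigenvalue_seq A E th).
Local Notation V i := (eigenspace A (t i)).

Let V_idem i : V i *m E i = V i. Proof. by case: (EA i). Qed.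
Let V_idem0 i j : j != i -> V j *m E i = 0.
Proof. by case: (EA i) => _; apply. Qed.

(** By diagonalizability the eigenspaces span V. Identities between primitive idempotents can then
    be checked on eigenspaces, where [prim_idem] prescribes them. *)
Lemma eigen_ordering_ext (X Y : M) : (forall i, V i *m X = V i *m Y) -> X = Y.
Proof.
move=> H; apply/eqP; rewrite -subr_eq0 -submx0.
have /diagonalizablePeigen[rs _ rs1] := Adiag.
rewrite -[X - Y]mul1mx; have : (1%:M <= kermx (X - Y))%MS.
  rewrite -rs1; apply: (big_ind (fun W : M => (W <= kermx (X - Y))%MS)).
  - exact: sub0mx.
  - by move=> U W HU HW; rewrite addsmx_sub HU.
  move=> r _; case: (boolP (eigenvalue A r)) => [|]; last first.
    by rewrite negbK => /eqP ->; apply: sub0mx.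
  case: At => _ _ /(_ r) complete /complete[i ->].
  by apply/sub_kermxP; rewrite mulmxBr H subrr.
by move/sub_kermxP ->; apply: submx_refl.
Qed.

Let V_neq0 i : V i != 0. Proof. by case: At => _ /(_ i). Qed.

Let V_A i : V i *m A = t i *: V i. Proof. exact/eigenspaceP. Qed.

Lemma eigen_ordering_th i : t i = th i.
Proof.
have : (t i - th i) *: V i = 0.
  rewrite scalerBl -V_A; have := congr1 (mulmx (V i)) (Eth i).
  by rewrite mulmxA V_idem -scalemxAr V_idem => ->; rewrite subrr.
move/eqP; rewrite scaler_eq0 (negPf (V_neq0 i)) orbF subr_eq0 => /eqP.
by [].
Qed.

Lemma prim_idemM i j : E i * E j = if i == j then E i else 0.
Proof.
apply: eigen_ordering_ext => k; rewrite mulmxA.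
have [<-|ki] := eqVneq k i; last first.
  by rewrite V_idem0 // mul0mx; case: ifP; rewrite ?mulmx0 // V_idem0.
by rewrite V_idem; case: eqVneq => [<-|ne]; rewrite ?V_idem // V_idem0 // mulmx0.
Qed.

Lemma prim_idem1 : \sum_i E i = 1.
Proof.
apply: eigen_ordering_ext => k; rewrite mulmx1 mulmx_sumr (bigD1 k) //= V_idem.
by rewrite big1 ?addr0 // => i ik; rewrite V_idem0 // eq_sym.
Qed.

Lemma prim_idem_aE : A = \sum_(i < d.+1) th i *: E i.
Proof.
apply: eigen_ordering_ext => k; rewrite V_A mulmx_sumr (bigD1 k) //=.
rewrite -scalemxAr V_idem big1 ?addr0 => [|i ik].
  by congr (_ *: _); apply: eigen_ordering_th.
by rewrite -scalemxAr V_idem0 ?scaler0 // eq_sym.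
Qed.

Lemma prim_idem_neq0 i : E i != 0.
Proof. by apply: contra_neq (V_neq0 i) => E0; rewrite -V_idem E0 mulmx0. Qed.

Lemma prim_idem_th_inj i j : (i <= d)%N -> (j <= d)%N -> i <> j -> th i <> th j.
Proof.
move=> li lj ne E1; apply: ne; rewrite -ltnS in li; rewrite -ltnS in lj.
have := eigen_ordering_th (Ordinal li); have := eigen_ordering_th (Ordinal lj).
rewrite /= -E1 => <- E2; case: At => inj _ _.
by have /(congr1 val) := inj _ _ E2.
Qed.

Lemma prim_idem_tridiag As : standard_ordering A As t ->
  forall i j : 'I_d.+1, (1 < maxn i j - minn i j)%N -> E i * As * E j = 0.
Proof.
move=> Hs i j lij; have EV : (E i <= V i)%MS.
  by apply/eigenspaceP; rewrite eigen_ordering_th; apply: Eth.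
apply/sub_kermxP.
apply: (submx_trans (submxMr _ EV)); apply: (submx_trans (Hs i)).
have HV k : k != j -> (V k <= kermx (E j))%MS.
  by move=> kj; apply/sub_kermxP; rewrite V_idem0.
rewrite !addsmx_sub; apply/andP; split; [apply/andP; split|].
- case: (nat_of_ord i) (ltn_ord i) lij => [|k] lk lkj; first exact: sub0mx.
  by apply: HV; rewrite -val_eqE /= inordK //; lia.
- by apply: HV; rewrite -val_eqE /=; lia.
case: ltnP => lid; last exact: sub0mx.
by apply: HV; rewrite -val_eqE /= inordK //; lia.
Qed.

End FromEigen.

Section ToEigen.
Variables (A As : M) (E Es : 'I_d.+1 -> M) (th ths : nat -> F).
Hypotheses (HT : T_relations th ths A E As Es) (Eneq0 : forall i, E i != 0).
Hypothesis th_inj : forall i j, (i <= d)%N -> (j <= d)%N -> i <> j -> th i <> th j.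
Local Notation V i := (eigenspace A (th (nat_of_ord i))).

Let E_A i : E i *m A = th i *: E i.
Proof. exact: (idem_a (T_idemM HT) (T_aE HT)). Qed.
Let A_E i : A *m E i = th i *: E i.
Proof. exact: (a_idem (T_idemM HT) (T_aE HT)). Qed.

Let EV (i : 'I_d.+1) : (E i <= V i)%MS. Proof. exact/eigenspaceP/E_A. Qed.

Let eigen_idem m (X : 'M_(m, n.+1)) c (i : 'I_d.+1) :
  X *m A = c *: X -> c != th i -> X *m E i = 0.
Proof.
move=> XA ne; have := congr1 (mulmx^~ (E i)) XA.
rewrite -mulmxA A_E -scalemxAr -scalemxAl => /esym/eqP.
by rewrite -subr_eq0 -scalerBl scaler_eq0 subr_eq0 (negPf ne) => /eqP.
Qed.

Let sumE m (X : 'M_(m, n.+1)) : X = \sum_i X *m E i.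
Proof. by rewrite -mulmx_sumr (T_idem1 HT) mulmx1. Qed.

Let V_idem (i : 'I_d.+1) : V i *m E i = V i.
Proof.
rewrite [RHS]sumE (bigD1 i) //= big1 ?addr0 // => j ji.
apply: (eigen_idem (c := th i)); first exact/eigenspaceP.
by rewrite (th_eq th_inj) eq_sym.
Qed.

Let VE (i : 'I_d.+1) : (V i <= E i)%MS. Proof. by rewrite -V_idem submxMl. Qed.

Lemma T_eigen_ordering : eigen_ordering A (fun i : 'I_d.+1 => th i).
Proof.
split=> [i j /eqP|i|c].
- by rewrite (th_eq th_inj) => /eqP.
- by apply: contra_neq (Eneq0 i) => V0; apply/eqP; rewrite -submx0 -V0.
have [/existsP[i /eqP ->]|] := boolP [exists i : 'I_d.+1, c == th i].
  by exists i.
rewrite negb_exists => /forallP H /negP[]; apply/eqP.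
rewrite [eigenspace _ _]sumE big1 // => i _.
by apply: (eigen_idem (c := c)) (H i); apply/eigenspaceP.
Qed.

Lemma T_diagonalizable : diagonalizable A.
Proof.
apply/diagonalizablePeigen; exists [seq th i | i : 'I_d.+1].
  rewrite map_inj_uniq ?enum_uniq // => i j /eqP.
  by rewrite (th_eq th_inj) => /eqP.
apply/eqmxP; rewrite submx1 /= big_map.
rewrite -[1%:M](T_idem1 HT) big_enum /=.
by apply: summx_sub => i _; apply: (sumsmx_sup i).
Qed.

Lemma T_prim_idem i : prim_idem A (fun i : 'I_d.+1 => th i) i (E i).
Proof.
split=> [|j ji]; first exact: V_idem.
by rewrite -V_idem -mulmxA [X in _ *m X](T_idemM HT) (negPf ji) mulmx0.
Qed.

Lemma T_standard_ordering : standard_ordering A As (fun i : 'I_d.+1 => th i).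
Proof.
move=> i; apply: (submx_trans (submxMr _ (VE i))).
rewrite [E i *m As]sumE; apply: summx_sub => j _.
case: (ltnP 1 (maxn i j - minn i j)) => lij.
  by rewrite [X in (X <= _)%MS](T_tridiag HT) // sub0mx.
apply: (submx_trans (submxMl _ _)); apply: (submx_trans (EV j)).
have [ji|ij|/val_inj ->] := ltngtP j i.
- apply: submx_trans (addsmxSl _ _); apply: submx_trans (addsmxSl _ _).
  case: (nat_of_ord i) lij ji => // k lij ji.
  by rewrite (_ : inord k = j) //; apply: val_inj; rewrite /= inordK;
    have := ltn_ord j; lia.
- apply: submx_trans (addsmxSr _ _).
  have -> : (i < d)%N by have := ltn_ord j; lia.
  by rewrite (_ : inord i.+1 = j) //; apply: val_inj; rewrite /= inordK;
    have := ltn_ord j; lia.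
exact: submx_trans (addsmxSr _ _) (addsmxSl _ _).
Qed.

End ToEigen.
End EigenData.

(** * The split sequence and (C2) *)

Lemma etaE (F : fieldType) (d i : nat) (th : nat -> F) x : (i <= d)%N ->
  Defs.eta d th (d - i) x = \prod_(i <= j < d) (x - th j.+1).
Proof.
move=> id_; rewrite /Defs.eta big_nat_rev -[X in \prod_(X <= _ < _) _]add0n big_addn big_mkord.
apply: eq_bigr => j _; congr (_ - th _); have := ltn_ord j; lia.
Qed.

(** Newton expansion, by X - th_(n+1) = (X - th_0) + (th_0 - th_(n+1)). For n = d the coefficients
    are the eta_(d-i)(th_0) of (C2). *)
Lemma shifted_node_prod (F : fieldType) (th : nat -> F) n :
  \prod_(j < n) ('X - (th j.+1)%:P) =
    \sum_(i < n.+1) (\prod_(i <= j < n) (th 0%N - th j.+1)) *: node_prod th 0 i.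
Proof.
have npS k : node_prod th 0 k.+1 = ('X - (th 0%N)%:P) * \prod_(j < k) ('X - (th j.+1)%:P).
  by rewrite /node_prod big_ord_recl.
elim: n => [|n IH].
  by rewrite big_ord0 big_ord1 big_geq // scale1r /node_prod big_ord0.
rewrite big_ord_recr /= {1}IH [RHS]big_ord_recr /= big_geq // scale1r npS.
have -> : \sum_(i < n.+1) (\prod_(i <= j < n.+1) (th 0%N - th j.+1)) *: node_prod th 0 i =
    (th 0%N - th n.+1)%:P * \prod_(j < n) ('X - (th j.+1)%:P).
  rewrite IH mulr_sumr; apply: eq_bigr => i _.
  by rewrite big_nat_recr -1?ltnS //= mulrC -scalerA mul_polyC.
by rewrite -IH polyCB; ring.
Qed.

Section SplitSequence.
Variables (F : fieldType) (d : nat) (th ths zeta : nat -> F) (B : algType F).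
Variables (a : B) (e : 'I_d.+1 -> B) (as_ : B) (es : 'I_d.+1 -> B).
Hypothesis HT : T_relations th ths a e as_ es.
Hypothesis HC1 : C1 d th ths.
Local Notation es0 := (es ord0).

Definition split_rel := forall i : 'I_d.+1, es0 * tau_alg th i a * es0 =
  (zeta i / \prod_(1 <= j < i.+1) (ths 0%N - ths j)) *: es0.

Hypothesis Hsplit : split_rel.

Let horner1 (p : {poly F}) (i : 'I_d.+1) : (forall j, j != i -> p.[th j] = 0) ->
  horner_alg a p = p.[th i] *: e i.
Proof.
move=> H; rewrite (horner_algE (T_idemM HT) (T_idem1 HT) (T_aE HT)) (bigD1 i) //=.
by rewrite big1 ?addr0 // => j ji; rewrite H // scale0r.
Qed.

(** tau_d vanishes at every eigenvalue except th_d, so tau_d(a) is a nonzero multiple of e_d. *)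
Lemma split_e_max : exists2 c, c != 0 &
  es0 * e ord_max * es0 = (c * zeta d) *: es0.
Proof.
have := Hsplit ord_max; rewrite tau_algE /=; set N := \prod_(_ <= _ < _) _.
rewrite (@horner1 _ ord_max) => [|j jd]; last first.
  rewrite horner_node_prod_eq0 // add0n /= ltn_neqAle -ltnS ltn_ord.
  by rewrite -val_eqE /= in jd; rewrite jd.
set p := _.[_] => E.
have p0 : p != 0.
  rewrite /p horner_prod; apply/prodf_neq0 => j _; rewrite hornerXsubC subr_eq0.
  rewrite add0n /=; apply/eqP/(proj1 HC1) => //; first exact: ltnW.
  by apply/eqP; rewrite gtn_eqF.
have N0 : N != 0.
  rewrite /N big_add1 big_mkord; apply/prodf_neq0 => j _; rewrite subr_eq0.
  by apply/eqP/(proj2 HC1).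
exists (p^-1 * N^-1); first by rewrite mulf_neq0 ?invr_neq0.
rewrite -[in RHS]mulrA [N^-1 * _]mulrC -scalerA -E -scalerAr -scalerAl scalerA.
by rewrite mulVf // scale1r.
Qed.

(** The product of the X - th_j over 1 <= j <= d, evaluated at a, is a nonzero multiple of e_0; its
    Newton expansion reduces the claim to the split relations. The dual eta factors are what remains
    of the common denominator [N]. *)
Lemma split_e_0 : exists2 c, c != 0 &
  es0 * e ord0 * es0 =
    (c * \sum_(i < d.+1) Defs.eta d th (d - i) (th 0%N) * Defs.eta d ths (d - i) (ths 0%N)
                       * zeta i) *: es0.
Proof.
pose q : {poly F} := \prod_(j < d) ('X - (th j.+1)%:P).
have Eq : horner_alg a q = q.[th 0%N] *: e ord0.
  apply: (@horner1 _ ord0) => j; rewrite -val_eqE /= => j0.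
  have lj : (j.-1 < d)%N by have := ltn_ord j; lia.
  rewrite horner_prod (bigD1 (Ordinal lj)) //= hornerXsubC prednK ?lt0n //.
  by rewrite subrr mul0r.
have q0 : q.[th 0%N] != 0.
  rewrite horner_prod; apply/prodf_neq0 => j _; rewrite hornerXsubC subr_eq0.
  by apply/eqP/(proj1 HC1).
pose N := \prod_(0 <= j < d) (ths 0%N - ths j.+1).
have N0 : N != 0.
  rewrite /N big_mkord; apply/prodf_neq0 => j _; rewrite subr_eq0.
  by apply/eqP/(proj2 HC1).
exists ((q.[th 0%N])^-1 * N^-1); first by rewrite mulf_neq0 ?invr_neq0.
rewrite -[in RHS]mulrA -scalerA.
have -> : es0 * e ord0 * es0 = (q.[th 0%N])^-1 *: (es0 * horner_alg a q * es0).
  by rewrite Eq -scalerAr -scalerAl scalerA mulVf // scale1r.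
congr (_ *: _); rewrite /q shifted_node_prod raddf_sum /= mulr_sumr mulr_suml.
rewrite mulr_sumr scaler_suml; apply: eq_bigr => i _.
have id_ : (i <= d)%N by rewrite -ltnS.
rewrite -mul_polyC rmorphM /= horner_algC mulr_algl -scalerAr -scalerAl.
rewrite -tau_algE Hsplit scalerA !etaE //; congr (_ *: _).
rewrite big_add1 /=; set x := \prod_(i <= _ < _) _; set z := \prod_(i <= _ < _) _.
have NE : N = \prod_(0 <= j < i) (ths 0%N - ths j.+1) * z by rewrite -big_cat_nat.
set y := \prod_(0 <= _ < i) _ in NE *.
move: N0; rewrite NE mulf_eq0 negb_or => /andP[y0 z0].
by field; apply/andP.
Qed.
End SplitSequence.

(** * Condition (C3) *)

Lemma cubic_step (F : fieldType) (p : {poly F}) (x y : F) : (size p <= 4)%N ->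
  x != y -> p.[x] - p.[y] = x * y * (x - y) ->
  p`_3 * (x ^+ 2 + x * y + y ^+ 2) + p`_2 * (x + y) + p`_1 = x * y.
Proof.
move=> sp xy H; have xy0 : x - y != 0 by rewrite subr_eq0.
apply: (mulIf xy0); rewrite -H !(horner_coef_wide _ sp) !big_ord_recl !big_ord0 /=.
rewrite /bump /= !add1n; ring.
Qed.

(** Two further divided differences of [cubic_step]: the first gives p_3 (x + y + z) + p_2 = y and
    its shift p_3 (y + z + w) + p_2 = z; subtracting them gives the claim. *)
Lemma cubic_ratio (F : fieldType) (p : {poly F}) (x y z w : F) : (size p <= 4)%N ->
  x != y -> y != z -> z != w -> x != z -> y != w ->
  p.[x] - p.[y] = x * y * (x - y) -> p.[y] - p.[z] = y * z * (y - z) ->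
  p.[z] - p.[w] = z * w * (z - w) -> p`_3 * (x - w) = y - z.
Proof.
move=> sp xy yz zw xz yw /(cubic_step sp xy) E1 /(cubic_step sp yz) E2.
move=> /(cubic_step sp zw) E3.
have G1 : p`_3 * (x + y + z) + p`_2 = y.
  have xz0 : x - z != 0 by rewrite subr_eq0.
  apply: (mulIf xz0); rewrite [RHS](_ : _ = x * y - y * z); last by ring.
  by rewrite -E1 -E2; ring.
have G2 : p`_3 * (y + z + w) + p`_2 = z.
  have yw0 : y - w != 0 by rewrite subr_eq0.
  apply: (mulIf yw0); rewrite [RHS](_ : _ = y * z - z * w); last by ring.
  by rewrite -E2 -E3; ring.
transitivity (p`_3 * (x + y + z) + p`_2 - (p`_3 * (y + z + w) + p`_2)).
  by ring.
by rewrite G1 G2.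
Qed.

Section Ratio.
Variables (F : fieldType) (d : nat) (th ths : nat -> F) (B : algType F).
Variables (a : B) (e : 'I_d.+1 -> B) (as_ : B) (es : 'I_d.+1 -> B).
Hypothesis HT : T_relations th ths a e as_ es.
Hypothesis HC1 : C1 d th ths.
Let HTd := T_relations_dual HT.
Local Notation pa := (horner_alg a).

Let es_pow0 (i j : 'I_d.+1) k : (k < maxn i j - minn i j)%N -> es i * a ^+ k * es j = 0.
Proof.
move=> lk; have := T_band HTd (w := 'X^k) (i := i) (j := j).
by rewrite rmorphXn /= horner_algX size_polyXn; apply.
Qed.

Let es_top (i j : 'I_d.+1) k (p : {poly F}) : (j = i + k :> nat)%N ->
  (size p <= k.+1)%N -> es i * pa p * es j = p`_k *: (es i * a ^+ k * es j).
Proof.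
move=> jik sp; rewrite -[p in pa p](subrK (p`_k *: 'X^k)) addrC horner_algP.
rewrite mulrDr mulrDl rmorphXn /= horner_algX -scalerAr -scalerAl.
rewrite [X in _ + X](T_band HTd) ?addr0 // jik.
have -> : (maxn i (i + k) - minn i (i + k) = k)%N by lia.
apply/leq_sizeP => l lkl; rewrite coefB coefZ coefXn.
have [->|ne] := eqVneq l k; first by rewrite mulr1 subrr.
by rewrite mulr0 subr0 nth_default // (leq_trans sp) // ltn_neqAle eq_sym ne.
Qed.

(** The word has just enough factors a to climb from i to j, so after k of them it must be at index
    i + k. *)
Let es_diag (i j : 'I_d.+1) k l (c : nat -> F) : (j = i + k + l :> nat)%N ->
  es i * a ^+ k * diag_el es c * a ^+ l * es j =
    c (i + k)%N *: (es i * a ^+ (k + l) * es j).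
Proof.
move=> jikl; have lik : (i + k < d.+1)%N by have := ltn_ord j; lia.
have X c' : es i * a ^+ k * diag_el es c' * a ^+ l * es j =
    c' (i + k)%N *: (es i * a ^+ k * es (Ordinal lik) * a ^+ l * es j).
  rewrite /diag_el mulr_sumr 2!mulr_suml (bigD1 (Ordinal lik)) //= big1 => [|s ns].
    by rewrite addr0 -scalerAr -!scalerAl.
  rewrite -val_eqE /= in ns; rewrite -scalerAr -!scalerAl.
  case: (ltnP (i + k)%N s) => ls.
    by rewrite es_pow0 ?mul0r ?scaler0 //; lia.
  by rewrite -!mulrA [es s * _]mulrA es_pow0 ?mulr0 ?scaler0 //; lia.
(* The constant function 1 removes the diagonal factor and identifies the surviving term with the
   power of a. *)
rewrite X exprD; have := X (fun=> 1).
rewrite scale1r /diag_el -scaler_sumr (T_idem1 HTd) scale1r mulr1 => <-.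
by rewrite !mulrA.
Qed.

Let es_diag0 (i j : 'I_d.+1) k l (c : nat -> F) : (i + k + l < j)%N ->
  es i * a ^+ k * diag_el es c * a ^+ l * es j = 0.
Proof.
move=> lj; rewrite /diag_el mulr_sumr 2!mulr_suml big1 // => s _.
rewrite -scalerAr -!scalerAl; case: (ltnP (i + k)%N s) => ls.
  by rewrite es_pow0 ?mul0r ?scaler0 //; lia.
by rewrite -!mulrA [es s * _]mulrA es_pow0 ?mulr0 ?scaler0 //; lia.
Qed.

Lemma corner_pow i : es ord0 * e i * es ord_max != 0 ->
  es ord0 * a ^+ d * es ord_max != 0.
Proof.
apply: contra_neq => X0.
rewrite (idem_poly (T_idemM HT) (T_idem1 HT) (T_aE HT) (proj1 HC1)).
by rewrite (@es_top _ _ d) ?size_lagrange_node // X0 scaler0.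
Qed.

Hypothesis corner : es ord0 * a ^+ d * es ord_max != 0.

(** Words of minimal length pass through every intermediate index, so es_i a^k es_j is a factor of
    the nonzero corner. *)
Let es_pow_neq0 (i j : 'I_d.+1) k : (j = i + k :> nat)%N -> es i * a ^+ k * es j != 0.
Proof.
move=> jik; apply: contra_neq corner => X0.
have split_pow (u v s : 'I_d.+1) m l : s = (u + m)%N :> nat -> v = (u + m + l)%N :> nat ->
    es u * a ^+ (m + l) * es v = es u * a ^+ m * es s * a ^+ l * es v.
  move=> sE vE; have := @es_diag u v m l (fun t => (t == s)%:R) vE.
  rewrite sE eqxx scale1r => <-; congr (_ * _ * _ * _).
  rewrite /diag_el (bigD1 s) //= -sE eqxx scale1r big1 ?addr0 // => t ts.
  by rewrite (_ : (t == s :> nat) = false) ?scale0r //; apply/negbTE.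
have lj := ltn_ord j.
suff H m : m = (i + (k + (d - j)))%N -> es ord0 * a ^+ m * es ord_max = 0.
  by apply: H; lia.
move=> ->; rewrite (split_pow _ _ i) //=; last by lia.
rewrite -2!mulrA [es i * _]mulrA (split_pow _ _ j) //=; last by lia.
by rewrite X0 !mul0r mulr0.
Qed.

Lemma es_neq0 i : es i != 0.
Proof.
have := @es_pow_neq0 i i 0 (esym (addn0 _)); rewrite expr0 mulr1.
by rewrite (T_idemM HTd) eqxx.
Qed.

Lemma T_C3 : C3 d th ths.
Proof.
case: (ltnP d 3) => d3.
  by exists 0 => i i2 id_; lia.
have [th_inj ths_inj] := HC1.
have asE : as_ = diag_el es ths := T_aE HTd.
have aE : a = diag_el e th := T_aE HT.
(* These differences make both sides of [comm] agree: the (i, j) entries are th_i th_j (th_i - th_j)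
   and p(th_i) - p(th_j) times e_i as_ e_j, which is 0 for |i - j| > 1. Partial sums serve as values
   of p. *)
have [p sp Hp] : exists2 p : {poly F}, (size p <= d.+1)%N & forall i, (i < d)%N ->
    p.[th i] - p.[th i.+1] = th i * th i.+1 * (th i - th i.+1).
  have [p sp Hp] := interpolation th_inj
    (fun i => - \sum_(k < i) th k * th k.+1 * (th k - th k.+1)).
  exists p => // i id_; rewrite !Hp ?big_ord_recr //=; last exact: ltnW.
  by rewrite opprK addKr.
have comm : a ^+ 2 * as_ * a ^+ 1 - a ^+ 1 * as_ * a ^+ 2 = pa p * as_ - as_ * pa p.
  apply: (idem_ext2 (T_idem1 HT)) => i j.
  have LR P Q : e i * (pa P * as_ * pa Q) * e j =
      (P.[th i] * Q.[th j]) *: (e i * as_ * e j).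
    rewrite !mulrA (idem_horner (T_idemM HT) (T_aE HT)) -!mulrA.
    rewrite (horner_idem (T_idemM HT) (T_idem1 HT) (T_aE HT)).
    by rewrite -!scalerAr -!scalerAl scalerA mulrC.
  have L : e i * (a ^+ 2 * as_ * a ^+ 1 - a ^+ 1 * as_ * a ^+ 2) * e j =
      (th i * th j * (th i - th j)) *: (e i * as_ * e j).
    have := LR 'X^2 'X^1; have := LR 'X^1 'X^2.
    rewrite !rmorphXn /= horner_algX !hornerXn => L1 L2.
    by rewrite mulrBr mulrBl L1 L2 -scalerBl; congr (_ *: _); ring.
  have R : e i * (pa p * as_ - as_ * pa p) * e j =
      (p.[th i] - p.[th j]) *: (e i * as_ * e j).
    rewrite mulrBr mulrBl !mulrA (idem_horner (T_idemM HT) (T_aE HT)) -!mulrA.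
    rewrite (horner_idem (T_idemM HT) (T_idem1 HT) (T_aE HT)) -!scalerAr -!scalerAl.
    by rewrite scalerBl !mulrA.
  rewrite L R; case: (ltnP 1 (maxn i j - minn i j)) => lij.
    by rewrite (T_tridiag HT) // !scaler0.
  congr (_ *: _); have [ij|ji|/val_inj ->] := ltngtP i j; last by rewrite !subrr mulr0.
    have -> : (j : nat) = i.+1 by lia.
    by rewrite Hp //; have := ltn_ord j; lia.
  have -> : (i : nat) = j.+1 by lia.
  rewrite -[RHS]opprB Hp; last by have := ltn_ord i; lia.
  by ring.
have rhs (i j : 'I_d.+1) : es i * (pa p * as_ - as_ * pa p) * es j =
    (ths j - ths i) *: (es i * pa p * es j).
  rewrite mulrBr mulrBl !mulrA (idem_a (T_idemM HTd) (T_aE HTd)) -!mulrA.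
  rewrite (a_idem (T_idemM HTd) (T_aE HTd)) -!scalerAr -!scalerAl.
  by rewrite scalerBl !mulrA.
have mul5A (x y z u v : B) : x * (y * z * u) * v = x * y * z * u * v by rewrite !mulrA.
have ths_neq0 i j : (i <= d)%N -> (j <= d)%N -> i <> j -> ths i - ths j != 0.
  by move=> *; rewrite subr_eq0; apply/eqP/ths_inj.
have th_neq i j : (i <= d)%N -> (j <= d)%N -> i <> j -> th i != th j.
  by move=> *; apply/eqP/th_inj.
have sp4 : (size p <= 4)%N.
  rewrite leqNgt; apply/negP => sp4.
  (* If deg p = t > 3, between es_0 and es_t the left side of [comm] vanishes, having only three
     factors a, while the right side keeps the leading coefficient of p. *)
  pose t := (size p).-1; have lt : (t < d.+1)%N by rewrite /t; lia.
  have := rhs ord0 (Ordinal lt); rewrite -comm mulrBr mulrBl !mul5A asE.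
  rewrite !es_diag0 /=; [|by rewrite /t; lia|by rewrite /t; lia].
  rewrite (@es_top _ _ t) //=; last by rewrite /t prednK //; lia.
  rewrite subrr scalerA => /esym/eqP; rewrite scaler_eq0 mulf_eq0.
  rewrite (negPf (es_pow_neq0 _)) // orbF (negPf (ths_neq0 _ _ _ _ _)) //=; last 1 first.
    by rewrite /t; lia.
  by rewrite -lead_coefE lead_coef_eq0 => /eqP p0; rewrite p0 size_poly0 in sp4.
(* The indices i - 2 and i + 1 are exactly 3 apart; the two words on the left meet [as_] at index i
   and i - 1. *)
have star i : (2 <= i)%N -> (i.+1 <= d)%N ->
    p`_3 * (ths (i - 2)%N - ths i.+1) = ths i.-1 - ths i.
  move=> i2 id_; have l2 : (i - 2 < d.+1)%N by lia.
  have l1 : (i.+1 < d.+1)%N by [].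
  have := rhs (Ordinal l2) (Ordinal l1); rewrite -comm mulrBr mulrBl !mul5A asE.
  rewrite !es_diag /=; [|by lia|by lia].
  rewrite (@es_top _ _ 3) //=; last by lia.
  rewrite -scalerBl scalerA; set X := es _ * _ * _.
  have X0 : X != 0 by apply: es_pow_neq0 => /=; lia.
  have -> : (i - 2 + 2 = i)%N by lia.
  have -> : (i - 2 + 1 = i.-1)%N by lia.
  move=> /eqP; rewrite -subr_eq0 -scalerBl scaler_eq0 (negPf X0) orbF subr_eq0.
  by move=> /eqP E; rewrite -[RHS]opprB E; ring.
have p3 : p`_3 != 0.
  have := star 2 isT d3; apply: contra_eq_neq => ->; rewrite mul0r eq_sym.
  by apply: ths_neq0 => //; lia.
exists (p`_3)^-1 => i i2 id_; split.
  have H : p`_3 * (th (i - 2)%N - th i.+1) = th i.-1 - th i.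
    have E1 : (i - 2).+1 = i.-1 by lia.
    have E2 : i.-1.+1 = i by lia.
    apply: (cubic_ratio sp4); try by apply: th_neq; lia.
    - by rewrite -E1 Hp //; lia.
    - by rewrite -[in X in _ - X]E2 Hp ?E2 //; lia.
    by rewrite Hp //; lia.
  rewrite -H invfM mulrA mulrAC divff ?mul1r // subr_eq0.
  by apply: th_neq; lia.
rewrite -star // invfM mulrA mulrAC divff ?mul1r //.
by apply: ths_neq0; lia.
Qed.
End Ratio.

(** * Tridiagonal systems as irreducible modules, and their nonzero corners *)

Section TDData.
Variables (F : fieldType) (n d : nat) (th ths : nat -> F).
Variables (A As : 'M[F]_n.+1) (E Es : 'I_d.+1 -> 'M[F]_n.+1).

(** A tridiagonal system with its eigenvalues, seen as an irreducible T-module on which no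
    idempotent vanishes; the two lemmas that follow translate in both directions. *)
Record TD_data : Prop := {
  TD_rel : T_relations th ths A E As Es;
  TD_C1 : C1 d th ths;
  TD_irr : irreducible_pair A As;
  TD_E_neq0 : forall i, E i != 0;
  TD_Es_neq0 : forall i, Es i != 0 }.

Lemma TD_system_data : TD_system A E As Es -> eigenvalue_seq A E th ->
  eigenvalue_seq As Es ths -> TD_data.
Proof.
case=> [[dA dAs _ _ irr] [t [At At_std At_E]] [ts [Ats Ats_std Ats_E]]] Eth Ests.
have EM := prim_idemM dA At At_E; have EsM := prim_idemM dAs Ats Ats_E.
have E1 := prim_idem1 dA At At_E; have Es1 := prim_idem1 dAs Ats Ats_E.
split=> [||//||].
- split=> //.
    by split; [apply: prim_idem_aE At At_E Eth|apply: prim_idem_aE Ats Ats_E Ests].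
  move=> i j k _ kij; split; apply: tridiag_pow => //.
    exact: (prim_idem_tridiag Ats Ats_E Ests Ats_std).
  exact: (prim_idem_tridiag At At_E Eth At_std).
- by split; [apply: prim_idem_th_inj At At_E Eth|apply: prim_idem_th_inj Ats Ats_E Ests].
- exact: prim_idem_neq0 At At_E.
exact: prim_idem_neq0 Ats Ats_E.
Qed.

Lemma TD_data_dual_rel : TD_data -> T_relations ths th As Es A E.
Proof. by case=> /T_relations_dual. Qed.

Lemma TD_data_system : TD_data ->
  [/\ TD_system A E As Es, eigenvalue_seq A E th & eigenvalue_seq As Es ths].
Proof.
move=> D; case: (D) => HT [th_inj ths_inj] irr E0 Es0; have HTd := TD_data_dual_rel D.
split; last 2 first.
- by move=> i; apply: (idem_a (T_idemM HT) (T_aE HT)).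
- by move=> i; apply: (idem_a (T_idemM HTd) (T_aE HTd)).
have eA := T_eigen_ordering HT E0 th_inj; have eAs := T_eigen_ordering HTd Es0 ths_inj.
have sA := T_standard_ordering HT th_inj; have sAs := T_standard_ordering HTd ths_inj.
split.
- split=> //.
  + exact: (T_diagonalizable HT th_inj).
  + exact: (T_diagonalizable HTd ths_inj).
  + by exists d, (fun i => th i).
  by exists d, (fun i => ths i).
- by exists (fun i => th i); split=> // i; apply: (T_prim_idem HT th_inj).
by exists (fun i => ths i); split=> // i; apply: (T_prim_idem HTd ths_inj).
Qed.
End TDData.

Section Corners.
Variables (F : fieldType) (n d : nat) (th ths : nat -> F).
Variables (A As : 'M[F]_n.+1) (E Es : 'I_d.+1 -> 'M[F]_n.+1).
Hypotheses (HT : T_relations th ths A E As Es) (irr : irreducible_pair A As).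
Hypotheses (E0 : E ord0 != 0) (Ed : E ord_max != 0).
Hypotheses (Es0 : Es ord0 != 0) (Esd : Es ord_max != 0).
Let HTd := T_relations_dual HT.
Let irrd := irreducible_pairC irr.

Let rev0 : rev_ord (ord0 : 'I_d.+1) = ord_max.
Proof. by apply: val_inj; rewrite /= subn1. Qed.
Let rev_max : rev_ord (ord_max : 'I_d.+1) = ord0.
Proof. by rewrite -rev0 rev_ordK. Qed.

(** Z is injective on the row space of Y, so it cannot kill a nonzero X *m Y. Injectivity comes from
    [split_injective], its dual and their reversals. *)
Let transfer (X Y Z : 'M[F]_n.+1) : Y *m Y = Y ->
  (forall v : 'rV_n.+1, v *m Y = v -> v *m Z = 0 -> v = 0) ->
  X *m Y != 0 -> X *m Y *m Z != 0.
Proof.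
move=> YY inj; apply: contra_neq => XYZ; apply/row_matrixP => i; rewrite row0.
apply: inj; rewrite -row_mul; first by rewrite -mulmxA YY.
by rewrite XYZ row0.
Qed.

Let EE i : E i *m E i = E i. Proof. by rewrite [LHS](T_idemM HT) eqxx. Qed.
Let EsEs i : Es i *m Es i = Es i. Proof. by rewrite [LHS](T_idemM HTd) eqxx. Qed.

Lemma Es0_E0_Es0 : Es ord0 *m E ord0 *m Es ord0 != 0.
Proof.
apply: transfer (EE _) (split_injective HTd irrd Ed) _.
have := transfer (X := 1%:M) (EsEs _) (split_injective HT irr Esd).
by rewrite mul1mx; apply.
Qed.

Lemma Es0_Ed : Es ord0 *m E ord_max != 0.
Proof.
have := transfer (X := 1%:M) (EsEs _) (split_injective (T_relations_rev HT) irr Esd).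
by rewrite mul1mx rev0; apply.
Qed.

Lemma Es0_Ed_Es0 : Es ord0 *m E ord_max *m Es ord0 != 0.
Proof.
apply: transfer (EE _) _ Es0_Ed.
have := split_injective (T_relations_dual (T_relations_rev HT)) irrd.
by rewrite rev_max rev0 => /(_ E0).
Qed.

Lemma Es0_Ed_Esd : Es ord0 *m E ord_max *m Es ord_max != 0.
Proof.
apply: transfer (EE _) _ Es0_Ed.
have := split_injective (T_relations_rev (T_relations_dual (T_relations_rev HT))) irrd.
by rewrite rev_max !rev0 => /(_ E0).
Qed.

(** Es_0 is injective on E_0 V. For the constructed module this turns the bound on the rank of Es_0
    into sharpness. *)
Lemma rank_E0_le : (\rank (E ord0) <= \rank (Es ord0))%N.
Proof.
suff H : (E ord0 :&: kermx (Es ord0))%MS == 0.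
  by move/mxrank_injP: H => <-; apply: mxrankM_maxr.
rewrite -submx0; apply/rV_subP => v; rewrite sub_capmx => /andP[/submxP[w vw]].
move=> /sub_kermxP v0; rewrite submx0; apply/eqP.
by apply: (split_injective HTd irrd Ed) v0; rewrite vw -mulmxA EE.
Qed.

End Corners.

Lemma TD_necessary (F : fieldType) (n d : nat) (th ths zeta : nat -> F)
    (A As : 'M[F]_n.+1) (E Es : 'I_d.+1 -> 'M[F]_n.+1) :
  sharp_TD_system_param A E As Es th ths zeta ->
  [/\ C1 d th ths, C2 d th ths zeta & C3 d th ths].
Proof.
case=> sys _ Eth Ests Hsplit; have D := TD_system_data sys Eth Ests.
case: (D) => HT HC1 irr En0 Esn0; split=> //; last first.
  apply: (T_C3 HT HC1); apply: (corner_pow HT HC1 (i := ord_max)).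
  exact: Es0_Ed_Esd HT irr (En0 _) (Esn0 _) (Esn0 _).
have split_r : split_rel th ths zeta A Es.
  move=> i; rewrite -Hsplit /tau_alg; congr (_ * _ * _); apply: eq_bigr => j _.
  by rewrite scalemx1.
split.
- have := Hsplit ord0; rewrite big_ord0 mulmx1 big_geq // divr1.
  rewrite [X in X = _](T_idemM (T_relations_dual HT)) eqxx => /eqP.
  rewrite -{1}[Es ord0]scale1r -subr_eq0 -scalerBl scaler_eq0 (negPf (Esn0 _)) orbF.
  by rewrite subr_eq0 => /eqP.
- have [c c0 Hc] := split_e_max HT HC1 split_r.
  have := Es0_Ed_Es0 HT irr (En0 _) (Esn0 _) (Esn0 _); rewrite [X in X != _]Hc => H z0.
  by rewrite z0 mulr0 scale0r eqxx in H.
have [c c0 Hc] := split_e_0 HT HC1 split_r.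
have := Es0_E0_Es0 HT irr (En0 _) (Esn0 _) (Esn0 _); rewrite [X in X != _]Hc => H z0.
by rewrite z0 mulr0 scale0r eqxx in H.
Qed.

(** * Uniqueness *)

Lemma es0_gen_scalar (F : fieldType) (d : nat) (th ths : nat -> F) (B : algType F)
    (a : B) (e : 'I_d.+1 -> B) (as_ : B) (es : 'I_d.+1 -> B) (z : nat -> F) :
  T_relations th ths a e as_ es -> C1 d th ths ->
  (forall k, (k <= d)%N -> es ord0 * tau_alg th k a * es ord0 = z k *: es ord0) ->
  forall x, gen_alg a as_ x -> exists c, es ord0 * x * es ord0 = c *: es ord0.
Proof.
move=> HT HC1 Hz; set es0 := es ord0 in Hz *.
have es0K : es0 * es0 = es0 by apply: (esK HT).
pose S x := exists c, x = c *: es0.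
have HS : lin_closed S.
  split=> [|c _ _ [x ->] [y ->]]; first by exists 0; rewrite scale0r.
  by exists (c * x + y); rewrite scalerDl scalerA.
have S1 p : S (es0 * horner_alg a p * es0).
  apply: (horner_alg_tau_ind HT (S := fun y => S (es0 * y * es0))) => [|k lk].
    split=> [|c y y' Sy Sy']; first by rewrite mulr0 mul0r; apply: lc0.
    by rewrite mulrDr mulrDl -scalerAr -scalerAl; apply: (proj2 HS).
  by exists (z k); apply: Hz.
apply: (es0_gen_ind HT HC1 HS) => // p _ [c ->].
by rewrite -/es0 -scalerAr -[_ * es0 * es0]mulrA es0K; apply/(lcZ HS)/S1.
Qed.

(** The preimage of W under J is invariant, hence 0 or everything, and v0 excludes the latter. *)
Lemma embedded_meets_trivially (F : fieldType) (k N : nat) (J : 'M[F]_(k.+1, N))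
    (a as_ W : 'M[F]_N) (A0 As0 : 'M[F]_k.+1) (v0 : 'rV[F]_k.+1) :
  irreducible_pair A0 As0 -> J *m a = A0 *m J -> J *m as_ = As0 *m J ->
  (W *m a <= W)%MS -> (W *m as_ <= W)%MS -> ~ (v0 *m J <= W)%MS ->
  forall m (u : 'M_(m, k.+1)), (u *m J <= W)%MS -> u = 0.
Proof.
move=> irr Ja Jas Wa Was v0W.
have [K HK] : exists K : 'M[F]_k.+1, forall u : 'rV_k.+1, (u *m J <= W)%MS <-> (u <= K)%MS.
  apply: (lin_closed_matrix (S := fun u => (u *m J <= W)%MS)).
  split=> [|c x y Hx Hy]; first by rewrite mul0mx sub0mx.
  by rewrite mulmxDl -scalemxAl addmx_sub // scalemx_sub.
have stab X X0 : J *m X = X0 *m J -> (W *m X <= W)%MS -> (K *m X0 <= K)%MS.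
  move=> JX WX; apply/row_subP => i; rewrite row_mul; apply/HK.
  rewrite -mulmxA -JX mulmxA; apply: submx_trans (submxMr _ _) WX.
  by apply/HK/row_sub.
move=> m u uW; apply/row_matrixP => i; rewrite row0; apply/eqP; rewrite -submx0.
have : (row i u <= K)%MS.
  by apply/HK; rewrite -row_mul; apply: submx_trans (row_sub _ _) uW.
case: (irr K (stab _ _ Ja Wa) (stab _ _ Jas Was)) => [/eqP|Kfull].
  by rewrite mxrank_eq0 => /eqP ->.
by case: v0W; apply/HK; apply: submx_full; rewrite /row_full Kfull.
Qed.

Section Block.
Variables (F : fieldType) (n m : nat).
Local Notation N := (n + m.+1)%N.

(** N.+1 is convertible to n.+1 + m.+1: the first form gives the matrix algebra structure, the
    second fits block matrices. Hence the explicit dimensions in the rewrites below. *)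
Definition blk (X : 'M[F]_n.+1) (Y : 'M[F]_m.+1) : 'M[F]_N.+1 := block_mx X 0 0 Y.

Lemma blkM X Y X' Y' : blk X Y * blk X' Y' = blk (X * X') (Y * Y').
Proof.
rewrite [LHS](@mulmx_block F n.+1 m.+1 n.+1 m.+1 n.+1 m.+1).
by rewrite !mulmx0 !mul0mx !addr0 !add0r.
Qed.

Lemma blkD X Y X' Y' : blk X Y + blk X' Y' = blk (X + X') (Y + Y').
Proof. by rewrite [LHS](@add_block_mx F n.+1 m.+1 n.+1 m.+1) !addr0. Qed.

Lemma blkZ c X Y : c *: blk X Y = blk (c *: X) (c *: Y).
Proof. by rewrite [LHS](@scale_block_mx F n.+1 m.+1 n.+1 m.+1) !scaler0. Qed.

Lemma blk0 : blk 0 0 = 0. Proof. exact: (@block_mx0 F n.+1 m.+1 n.+1 m.+1). Qed.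

Lemma blk1 : blk 1 1 = 1.
Proof. exact: (esym (@scalar_mx_block F n.+1 m.+1 1)). Qed.

Lemma blk_sum (I : finType) (f : I -> 'M[F]_n.+1) (g : I -> 'M[F]_m.+1) :
  \sum_i blk (f i) (g i) = blk (\sum_i f i) (\sum_i g i).
Proof.
elim/big_rec3: _ => [|i x y w _ ->]; first by rewrite blk0.
by rewrite blkD.
Qed.

Lemma blkX X Y k : blk X Y ^+ k = blk (X ^+ k) (Y ^+ k).
Proof. by elim: k => [|k IH]; rewrite ?expr0 ?blk1 // !exprS IH blkM. Qed.

Lemma blk_tau th k X Y : tau_alg th k (blk X Y) = blk (tau_alg th k X) (tau_alg th k Y).
Proof.
rewrite /tau_alg; elim/big_rec3: _ => [|i x y w _ ->]; first by rewrite blk1.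
by rewrite -blk1 -scaleN1r !blkZ blkD blkM !scaleN1r.
Qed.

Lemma blk_T_relations d (th ths : nat -> F) A E As Es A' E' As' Es' :
  @T_relations F d th ths _ A E As Es -> T_relations th ths A' E' As' Es' ->
  T_relations th ths (blk A A') (fun i => blk (E i) (E' i)) (blk As As')
    (fun i => blk (Es i) (Es' i)).
Proof.
case=> H1 H2 [H3 H4] [H5 H6] H7 [K1 K2 [K3 K4] [K5 K6] K7].
split.
- by move=> i j; rewrite blkM H1 K1; case: eqP => _; rewrite ?blk0.
- by move=> i j; rewrite blkM H2 K2; case: eqP => _; rewrite ?blk0.
- by rewrite !blk_sum H3 H4 K3 K4 blk1.
- by split; [rewrite H5 K5|rewrite H6 K6]; rewrite -blk_sum; apply: eq_bigr => i _;
    rewrite blkZ.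
move=> i j k kd kij; have [L1 L2] := H7 i j k kd kij; have [L3 L4] := K7 i j k kd kij.
by rewrite !blkX !blkM L1 L2 L3 L4 blk0.
Qed.

Definition inj1 : 'M[F]_(n.+1, N.+1) := row_mx 1%:M (0 : 'M_(n.+1, m.+1)).
Definition inj2 : 'M[F]_(m.+1, N.+1) := row_mx (0 : 'M_(m.+1, n.+1)) 1%:M.
Definition prj1 : 'M[F]_(N.+1, n.+1) := col_mx 1%:M (0 : 'M_(m.+1, n.+1)).
Definition prj2 : 'M[F]_(N.+1, m.+1) := col_mx (0 : 'M_(n.+1, m.+1)) 1%:M.

Lemma inj1_blk X Y : inj1 *m blk X Y = X *m inj1.
Proof.
rewrite [LHS](@mul_row_block F n.+1 n.+1 m.+1 n.+1 m.+1).
rewrite [RHS](@mul_mx_row F n.+1 n.+1 n.+1 m.+1).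
by rewrite !mul0mx !mulmx0 !mulmx1 !mul1mx !addr0.
Qed.

Lemma inj2_blk X Y : inj2 *m blk X Y = Y *m inj2.
Proof.
rewrite [LHS](@mul_row_block F m.+1 n.+1 m.+1 n.+1 m.+1).
rewrite [RHS](@mul_mx_row F m.+1 m.+1 n.+1 m.+1).
by rewrite !mul0mx !mulmx0 !mulmx1 !mul1mx !add0r.
Qed.

Lemma blk_prj1 X Y : blk X Y *m prj1 = prj1 *m X.
Proof.
rewrite [LHS](@mul_block_col F n.+1 m.+1 n.+1 m.+1 n.+1).
rewrite [RHS](@mul_col_mx F n.+1 m.+1 n.+1 n.+1).
by rewrite !mul0mx !mulmx0 !mulmx1 !mul1mx !addr0.
Qed.

Lemma blk_prj2 X Y : blk X Y *m prj2 = prj2 *m Y.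
Proof.
rewrite [LHS](@mul_block_col F n.+1 m.+1 n.+1 m.+1 m.+1).
rewrite [RHS](@mul_col_mx F n.+1 m.+1 m.+1 m.+1).
by rewrite !mul0mx !mulmx0 !mulmx1 !mul1mx !add0r.
Qed.

Lemma prj_sum k (u : 'M[F]_(k, N.+1)) :
  u = u *m prj1 *m inj1 + u *m prj2 *m inj2.
Proof.
rewrite -[LHS](@hsubmxK F k n.+1 m.+1); set u1 := lsubmx _; set u2 := rsubmx _.
have -> : u = row_mx u1 u2 by rewrite [RHS](@hsubmxK F k n.+1 m.+1).
rewrite [X in X *m inj1](@mul_row_col F k n.+1 m.+1 n.+1).
rewrite [X in X *m inj2](@mul_row_col F k n.+1 m.+1 m.+1).
rewrite !mulmx0 !mulmx1 addr0 add0r.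
rewrite [X in X + _](@mul_mx_row F k n.+1 n.+1 m.+1).
rewrite [X in _ + X](@mul_mx_row F k m.+1 n.+1 m.+1).
by rewrite !mulmx0 !mulmx1 [RHS](@add_row_mx F k n.+1 m.+1) addr0 add0r.
Qed.

Lemma inj1_prj1 : inj1 *m prj1 = 1%:M.
Proof.
by rewrite [LHS](@mul_row_col F n.+1 n.+1 m.+1 n.+1) mulmx1 mulmx0 addr0.
Qed.

Lemma inj1_prj2 : inj1 *m prj2 = 0.
Proof.
by rewrite [LHS](@mul_row_col F n.+1 n.+1 m.+1 m.+1) mulmx1 mulmx0 addr0.
Qed.

Lemma inj2_prj1 : inj2 *m prj1 = 0.
Proof.
by rewrite [LHS](@mul_row_col F m.+1 n.+1 m.+1 n.+1) mul0mx mulmx0 addr0.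
Qed.

Lemma inj2_prj2 : inj2 *m prj2 = 1%:M.
Proof.
by rewrite [LHS](@mul_row_col F m.+1 n.+1 m.+1 m.+1) mul0mx mulmx1 add0r.
Qed.
End Block.

Section Graph.
Variables (F : fieldType) (k p q : nat) (W1 : 'M[F]_(k, p)) (W2 : 'M[F]_(k, q)).
Hypotheses (full1 : row_full W1).

(** The rows of (W1, W2) span the graph of v -> v W1^-1 W2. The sizes k, p and q are only provably
    equal, so [pinvmx] serves as the inverse. *)
Lemma graph_inverse : row_free W2 ->
  pinvmx W1 *m W2 *m (pinvmx W2 *m W1) = 1%:M.
Proof.
by move=> free2; rewrite -mulmxA [W2 *m _]mulmxA (mulmxVp free2) mul1mx mulVpmx.
Qed.

Lemma graph_intertwines X Y Z : row_free W1 ->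
  W1 *m X = Z *m W1 -> W2 *m Y = Z *m W2 ->
  X *m (pinvmx W1 *m W2) = pinvmx W1 *m W2 *m Y.
Proof.
move=> /mulmxVp + Z1 Z2; move: (mulVpmx full1); move: (pinvmx W1) => L LW WL.
rewrite -[RHS]mulmxA Z2 -[X]mul1mx -LW -[L *m W1 *m X]mulmxA Z1 -!mulmxA.
by rewrite [W1 *m _]mulmxA WL mul1mx.
Qed.
End Graph.

(* The submodule generated by a pair of nonzero vectors of Es_0 V and Es'_0 V'
   meets Es_0 (V + V') in a line, hence is the graph of an isomorphism. *)
Lemma TD_unique (F : fieldType) (d n m : nat) (th ths zeta : nat -> F)
    (A As : 'M[F]_n.+1) (E Es : 'I_d.+1 -> 'M[F]_n.+1)
    (A' As' : 'M[F]_m.+1) (E' Es' : 'I_d.+1 -> 'M[F]_m.+1) :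
  sharp_TD_system_param A E As Es th ths zeta ->
  sharp_TD_system_param A' E' As' Es' th ths zeta ->
  TD_iso A E As Es A' E' As' Es'.
Proof.
case=> sys _ Eth Ests Hs [sys' _ Eth' Ests' Hs'].
case: (TD_system_data sys Eth Ests) => HT HC1 irr _ Es0.
case: (TD_system_data sys' Eth' Ests') => HT' _ irr' _ Es0'.
have HB := blk_T_relations HT HT'; have HBd := T_relations_dual HB.
set a := blk A A' in HB HBd; set as_ := blk As As' in HB HBd.
pose es0 := blk (Es ord0) (Es' ord0).
have nz_row k (X : 'M[F]_k.+1) : X * X = X -> X != 0 ->
    exists2 v : 'rV_k.+1, v != 0 & v *m X = v.
  move=> XX; have [i Hi|H] := pickP (fun i => row i X != 0).
    by exists (row i X) => //; rewrite -row_mul [X *m X]XX.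
  case/eqP; apply/row_matrixP => i; rewrite row0; apply/eqP/negPn/negP => Hi.
  by have := H i; rewrite Hi.
have [v v0 vE] := nz_row _ _ (esK HT ord0) (Es0 ord0).
have [v' v'0 vE'] := nz_row _ _ (esK HT' ord0) (Es0' ord0).
pose u := v *m inj1 F n m + v' *m inj2 F n m.
have scalar x : gen_alg a as_ x -> exists c, es0 * x * es0 = c *: es0.
  apply: (es0_gen_scalar HB HC1
     (z := fun k => zeta k / \prod_(1 <= j < k.+1) (ths 0%N - ths j))) => k lk.
  rewrite blk_tau !blkM blkZ; congr blk.
    rewrite -(Hs (Ordinal (lk : (k < d.+1)%N))); congr (_ * _ * _).
    by apply: eq_bigr => j _; rewrite scalemx1.
  rewrite -(Hs' (Ordinal (lk : (k < d.+1)%N))); congr (_ * _ * _).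
  by apply: eq_bigr => j _; rewrite scalemx1.
have [W HW] : exists W : 'M[F]_((n + m.+1).+1),
    forall w, (exists2 x, gen_alg a as_ x & w = u *m x) <-> (w <= W)%MS.
  apply: lin_closed_matrix; split.
    by exists 0; [apply: (lc0 (gen_lin_closed _ _))|rewrite mulmx0].
  move=> c _ _ [x gx ->] [y gy ->]; exists (c *: x + y); first exact: genP.
  by rewrite mulmxDr scalemxAr.
have stab x : gen_alg a as_ x -> (W *m x <= W)%MS.
  move=> gx; apply/row_subP => i; rewrite row_mul.
  have /HW[y gy ->] := row_sub i W; apply/HW; exists (y * x); first exact: genM.
  by rewrite -mulmxA.
have uW : (u <= W)%MS by apply/HW; exists 1; [apply: gen1|rewrite mulmx1].
have u_es0 : u *m es0 = u.
  by rewrite mulmxDl -!mulmxA inj1_blk inj2_blk !mulmxA vE vE'.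
have line w : (w <= W)%MS -> w *m es0 = w -> exists c, w = c *: u.
  case/HW=> x gx -> wE; have [c Hc] := scalar x gx; exists c.
  by rewrite -wE -{1}u_es0 -!mulmxA [_ *m (x *m es0)]mulmxA [X in _ *m X]Hc
    -scalemxAr u_es0.
have v1 : u *m prj1 F n m = v.
  by rewrite mulmxDl -!mulmxA inj1_prj1 inj2_prj1 mulmx1 mulmx0 addr0.
have v2 : u *m prj2 F n m = v'.
  by rewrite mulmxDl -!mulmxA inj1_prj2 inj2_prj2 mulmx1 mulmx0 add0r.
have K1 : forall k (w : 'M_(k, n.+1)), (w *m inj1 F n m <= W)%MS -> w = 0.
  apply: (embedded_meets_trivially (v0 := v) irr (inj1_blk A A') (inj1_blk As As')).
  - exact/stab/gen_a.
  - exact/stab/gen_as.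
  (* If (v, 0) = c (v, v') then c v' = 0, so c = 0 and v = 0. *)
  case/line=> [|c Hc]; first by rewrite -mulmxA inj1_blk mulmxA vE.
  have := congr1 (mulmx^~ (prj2 F n m)) Hc.
  rewrite -mulmxA inj1_prj2 mulmx0 -scalemxAl v2 => /esym/eqP.
  rewrite scaler_eq0 (negPf v'0) orbF => /eqP c0.
  have := congr1 (mulmx^~ (prj1 F n m)) Hc.
  by rewrite -mulmxA inj1_prj1 mulmx1 c0 scale0r mul0mx => /eqP; rewrite (negPf v0).
have K2 : forall k (w : 'M_(k, m.+1)), (w *m inj2 F n m <= W)%MS -> w = 0.
  apply: (embedded_meets_trivially (v0 := v') irr' (inj2_blk A A') (inj2_blk As As')).
  - exact/stab/gen_a.
  - exact/stab/gen_as.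
  case/line=> [|c Hc]; first by rewrite -mulmxA inj2_blk mulmxA vE'.
  have := congr1 (mulmx^~ (prj1 F n m)) Hc.
  rewrite -mulmxA inj2_prj1 mulmx0 -scalemxAl v1 => /esym/eqP.
  rewrite scaler_eq0 (negPf v0) orbF => /eqP c0.
  have := congr1 (mulmx^~ (prj2 F n m)) Hc.
  by rewrite -mulmxA inj2_prj2 mulmx1 c0 scale0r mul0mx => /eqP; rewrite (negPf v'0).
pose b := row_base W; pose W1 := b *m prj1 F n m; pose W2 := b *m prj2 F n m.
have bW k (w : 'M_(k, _)) : (w *m b <= W)%MS.
  by apply: submx_trans (submxMl _ _) _; rewrite eq_row_base.
have b_inj k (w : 'M_(k, _)) : w *m b = 0 -> w = 0.
  by move=> wb; apply: (row_free_inj (row_base_free W)); rewrite wb mul0mx.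
(* A vector of W with zero first component lies in the intersection of W with V', which is 0 by
   [K2]. *)
have free1 : row_free W1.
  rewrite -kermx_eq0; apply/eqP/b_inj; have := mulmx_ker W1.
  rewrite mulmxA => w1; have w2 : kermx W1 *m b *m prj2 F n m = 0.
    apply: K2; have := bW _ (kermx W1).
    by rewrite {1}(prj_sum (kermx W1 *m b)) w1 mul0mx add0r.
  by rewrite [LHS]prj_sum w1 w2 !mul0mx addr0.
have free2 : row_free W2.
  rewrite -kermx_eq0; apply/eqP/b_inj; have := mulmx_ker W2.
  rewrite mulmxA => w2; have w1 : kermx W2 *m b *m prj1 F n m = 0.
    apply: K1; have := bW _ (kermx W2).
    by rewrite {1}(prj_sum (kermx W2 *m b)) w2 mul0mx addr0.
  by rewrite [LHS]prj_sum w1 w2 !mul0mx addr0.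
(* The projection of W to a summand is a submodule containing a nonzero vector; [<<_>>] makes it the
   square matrix that irreducibility asks for. *)
have full k (P : 'M_(_, k.+1)) (X X' : 'M_k.+1) : irreducible_pair X X' ->
    a *m P = P *m X -> as_ *m P = P *m X' -> u *m P != 0 -> row_full (b *m P).
  move=> irrX aP asP uP; have stabP x Y : gen_alg a as_ x -> x *m P = P *m Y ->
      (<<W *m P>> *m Y <= <<W *m P>>)%MS.
    move=> gx xP; rewrite genmxE (eqmxMr _ (genmxE _)) -mulmxA -xP mulmxA.
    exact/submxMr/stab.
  have := irrX _ (stabP _ _ (gen_a _ _) aP) (stabP _ _ (gen_as _ _) asP).
  rewrite genmxE /row_full (eqmxMr _ (eq_row_base W)) => -[/eqP|-> //].
  rewrite mxrank_eq0 => /eqP WP; have := submxMr P uW.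
  by rewrite WP => /submx0null/eqP; rewrite (negPf uP).
have full1 : row_full W1.
  by apply: (full _ _ _ _ irr (blk_prj1 A A') (blk_prj1 As As')); rewrite v1.
have full2 : row_full W2.
  by apply: (full _ _ _ _ irr' (blk_prj2 A A') (blk_prj2 As As')); rewrite v2.
exists (pinvmx W1 *m W2).
have inter X Y : gen_alg a as_ (blk X Y) ->
    X *m (pinvmx W1 *m W2) = pinvmx W1 *m W2 *m Y.
  move=> gXY; have /submxP[Z HZ] : (b *m blk X Y <= b)%MS.
    by rewrite (eqmxMr _ (eq_row_base W)) eq_row_base stab.
  have Z1 : W1 *m X = Z *m W1 by rewrite /W1 -mulmxA -(blk_prj1 X Y) mulmxA HZ -mulmxA.
  have Z2 : W2 *m Y = Z *m W2 by rewrite /W2 -mulmxA -(blk_prj2 X Y) mulmxA HZ -mulmxA.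
  exact: graph_intertwines Z1 Z2.
split.
- split.
    by apply/row_freeP; exists (pinvmx W2 *m W1); apply: graph_inverse.
  by apply/row_fullP; exists (pinvmx W2 *m W1); apply: graph_inverse.
- exact/inter/gen_a.
- exact/inter/gen_as.
- by move=> i; apply: inter; apply: (gen_e HB HC1).
by move=> i; apply: inter; apply: (gen_es HB HC1).
Qed.

(** * Existence *)

Section Character.
Variables (F : fieldType) (d : nat) (th ths : nat -> F) (B : algType F).
Variables (a : B) (e : 'I_d.+1 -> B) (as_ : B) (es : 'I_d.+1 -> B).
Hypothesis HT : T_relations th ths a e as_ es.
Hypothesis HC1 : C1 d th ths.
Hypothesis mu_inj : forall p : {mpoly F[d]}, mu_eval th a (es ord0) p = 0 -> p = 0.
Local Notation es0 := (es ord0).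
Local Notation gen := (gen_alg a as_).
Local Notation mu := (@mu_eval F d th B a es0).

(** [mu] identifies es_0 T es_0 with the polynomial ring, so evaluation at (z_1, ..., z_d) is well
    defined there; chi x is the value at es_0 x es_0. Off [gen] the values are arbitrary. *)
Lemma character_exists (z : nat -> F) : z 0%N = 1 -> exists chi : B -> F,
  [/\ forall c x y, gen x -> gen y -> chi (c *: x + y) = c * chi x + chi y,
      forall x y, gen x -> gen y -> chi (x * es0 * y) = chi x * chi y,
      forall x, gen x -> chi (es0 * x) = chi x /\ chi (x * es0) = chi x,
      chi 1 = 1 &
      forall k, (k <= d)%N -> chi (tau_alg th k a) = z k].
Proof.
move=> z0; have inj p q : mu p = mu q -> p = q.
  move=> E; apply/eqP; rewrite -subr_eq0 addrC -scaleN1r; apply/eqP/mu_inj.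
  by rewrite muP E scaleN1r addNr.
have ex x : exists p, gen x -> es0 * x * es0 = mu p.
  have [gx|ngx] := boolp.EM (gen x); last by exists 0.
  by have [p Hp] := mu_surj HT HC1 gx; exists p.
have [P HP] := boolp.choice ex.
have es0K : es0 * es0 = es0 by apply: esK HT _.
have g0 : gen es0 by apply: (gen_es HT HC1).
pose chi x := (P x).@[fun k : 'I_d => z k.+1].
have chiE x p : gen x -> es0 * x * es0 = mu p -> chi x = p.@[fun k : 'I_d => z k.+1].
  by move=> gx; rewrite HP // => /inj E; rewrite /chi E.
exists chi; split.
- move=> c x y gx gy; rewrite (@chiE _ (c *: P x + P y)); last first.
  + by rewrite muP -!HP // mulrDr mulrDl -scalerAr -scalerAl.
  + exact: genP.
  by rewrite mevalD mevalZ.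
- move=> x y gx gy; rewrite (@chiE _ (P x * P y)) ?mevalM //.
    exact: genM (genM gx g0) gy.
  rewrite (muM HT HC1) -!HP // !mulrA -[es0 * x * es0 * es0]mulrA es0K //.
- move=> x gx; split.
    by apply: chiE; [apply: genM|rewrite mulrA es0K HP].
  by apply: chiE; [apply: genM|rewrite -!mulrA es0K mulrA HP].
- rewrite (@chiE _ 1) ?meval1 //; first exact: gen1.
  by rewrite mulr1 es0K (mu1 HT).
case=> [_|k lk].
  rewrite z0 (@chiE _ 1) ?meval1 // /tau_alg big_ord0; first exact: gen1.
  by rewrite mulr1 es0K (mu1 HT).
rewrite (@chiE _ 'X_(Ordinal lk)) ?mevalXU //; last by rewrite (muX HT).
by rewrite tau_algE; apply: gen_pa.
Qed.
End Character.

Section Existence.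
Variables (F : fieldType) (d : nat) (th ths zeta : nat -> F) (B : algType F).
Variables (a : B) (e : 'I_d.+1 -> B) (as_ : B) (es : 'I_d.+1 -> B).
Hypothesis HT : T_relations th ths a e as_ es.
Hypothesis HC1 : C1 d th ths.
Local Notation es0 := (es ord0).
Local Notation gen := (gen_alg a as_).
Variable chi : B -> F.
Hypothesis chiP : forall c x y, gen x -> gen y -> chi (c *: x + y) = c * chi x + chi y.
Hypothesis chiM : forall x y, gen x -> gen y -> chi (x * es0 * y) = chi x * chi y.
Hypothesis chi_es0 : forall x, gen x -> chi (es0 * x) = chi x /\ chi (x * es0) = chi x.
Hypothesis chi1 : chi 1 = 1.

Let g0 : gen es0. Proof. exact: gen_es HT HC1 _. Qed.
Let chi0 : chi 0 = 0.
Proof.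
have := chiP (-1) (gen1 a as_) (gen1 a as_).
by rewrite scaleN1r addNr mulN1r addNr.
Qed.

(* The module is gen / {f | chi (f * g) = 0 for all g}, with gen acting on the
   right; the class of es0 is fixed by es0 and generates it. *)
Lemma character_module : exists (n : nat) (rho : B -> 'M[F]_n.+1),
  [/\ T_relations th ths (rho a) (fun i => rho (e i)) (rho as_) (fun i => rho (es i)),
      irreducible_pair (rho a) (rho as_), rho es0 != 0, (\rank (rho es0) <= 1)%N &
      forall k, rho es0 * tau_alg th k (rho a) * rho es0 =
        chi (tau_alg th k a) *: rho es0].
Proof.
have [ws [gws Hws]] := finitely_generated HT HC1.
(* chi (f g) = chi (f g es0), and g es0 is a sum of terms w es0 g' es0 with w in [ws], for which chi
   (f w es0 g' es0) = chi (f w) chi (g' es0). *)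
have radical f : gen f -> (forall w, w \in ws -> chi (f * w) = 0) ->
    forall g, gen g -> chi (f * g) = 0.
  move=> gf Hf g gg; have [_ <-] := chi_es0 (genM gf gg); rewrite -mulrA.
  suff [] : gen (f * (g * es0)) /\ chi (f * (g * es0)) = 0 by [].
  elim: (Hws g gg) => {g gg}[|x y _ [gx Hx] _ [gy Hy]|w g /[dup] /gws gw ww gg].
  - by rewrite mulr0; split=> //; apply: (lc0 (gen_lin_closed _ _)).
  - rewrite mulrDr -[f * x]scale1r chiP // Hx Hy mulr0 addr0; split=> //.
    exact: genP.
  have gfw : gen (f * w) by apply: genM.
  have gg0 : gen (g * es0) by apply: genM.
  rewrite -[es0 * g * es0]mulrA !mulrA -[f * w * es0 * g * es0]mulrA.
  by split; [do !apply: genM|rewrite chiM // Hf // mul0r].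
have chi1n : chi 1 != 0 by rewrite chi1 oner_neq0.
have [n [rho [pi [[rho1 rhoP] rhoM [piP piM] pi_surj pi0]]]] :=
  quotient_module chiP chi1n gws radical.
exists n, rho.
have ga := gen_a a as_; have gas := gen_as a as_.
have ge i : gen (e i) by apply: (gen_e HT HC1).
have ges i : gen (es i) by apply: (gen_es HT HC1).
have gZ c x : gen x -> gen (c *: x) by apply: (lcZ (gen_lin_closed _ _)).
have gen0 : gen 0 by apply: (lc0 (gen_lin_closed _ _)).
have rho0 : rho 0 = 0.
  by have := rhoP (-1) _ _ (gen1 a as_) (gen1 a as_); rewrite !scaleN1r !addNr.
have rhoZ c x : gen x -> rho (c *: x) = c *: rho x.
  by move=> gx; rewrite -[c *: x]addr0 rhoP // rho0 addr0.
have rho_sum (f : 'I_d.+1 -> B) : (forall i, gen (f i)) ->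
    rho (\sum_i f i) = \sum_i rho (f i).
  move=> gf; suff [] : gen (\sum_i f i) /\ rho (\sum_i f i) = \sum_i rho (f i) by [].
  elim/big_rec2: _ => [//|i x y _ [gy E]]; split.
    by rewrite -[f i]scale1r; apply: genP.
  by rewrite -{1}[f i]scale1r rhoP // scale1r E.
have genX x k : gen x -> gen (x ^+ k).
  by move=> gx; elim: k => [|k IH]; [apply: gen1|rewrite exprS; apply: genM].
have rhoX x k : gen x -> rho (x ^+ k) = rho x ^+ k.
  by move=> gx; elim: k => [//|k IH]; rewrite !exprS rhoM ?IH //; apply: genX.
have rho_ext x y : gen x -> gen y ->
    (forall f, gen f -> pi (f * x) = pi (f * y)) -> rho x = rho y.
  move=> gx gy H; apply/row_matrixP => i; rewrite !rowE.
  by have [f gf ->] := pi_surj (delta_mx 0 i); rewrite -!piM //; apply: H.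
have pi_es0 f : gen f -> pi (es0 * f) = pi f.
  move=> gf; have g1 := genM g0 gf.
  have : pi ((-1) *: (es0 * f) + f) = 0.
    apply/pi0; first exact: genP.
    move=> g gg; rewrite mulrDl -scalerAl chiP; [|by do !apply: genM|exact: genM].
    by rewrite -mulrA (proj1 (chi_es0 (genM gf gg))) mulN1r addNr.
  by rewrite piP // scaleN1r addrC => /eqP; rewrite subr_eq0 => /eqP.
have pi_mul_es0 f : gen f -> pi (f * es0) = chi f *: pi es0.
  move=> gf; have g1 := genM gf g0.
  have : pi ((- chi f) *: es0 + f * es0) = 0.
    apply/pi0; first exact: genP.
    move=> g gg; rewrite mulrDl -scalerAl chiP; [|exact: genM|by do !apply: genM].
    by rewrite chiM // (proj1 (chi_es0 gg)) mulNr addNr.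
  by rewrite piP // scaleNr addrC => /eqP; rewrite subr_eq0 => /eqP.
have pi_es0_neq0 : pi es0 != 0.
  apply: contraNneq chi1n => /(pi0 _ g0) /(_ _ (gen1 _ _)).
  by rewrite (proj1 (chi_es0 (gen1 _ _))) => ->.
split.
- case: HT => H1 H2 [H3 H4] [H5 H6] H7; split.
  + by move=> i j; rewrite -[LHS]rhoM // H1; case: eqP.
  + by move=> i j; rewrite -[LHS]rhoM // H2; case: eqP.
  + by rewrite -!rho_sum // H3 H4.
  + split; [rewrite {1}H5|rewrite {1}H6]; rewrite rho_sum; try by move=> i; apply: gZ.
      by apply: eq_bigr => i _; rewrite rhoZ.
    by apply: eq_bigr => i _; rewrite rhoZ.
  move=> i j k kd kij; have [L1 L2] := H7 i j k kd kij.
  have ga_k := genX _ k ga; have gas_k := genX _ k gas.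
  by rewrite -!rhoX // -!rhoM ?L1 ?L2 //; apply: genM.
- move=> W WA WAs; case: (posnP (\rank W)) => [->|W0]; [by left|right].
  have stab x : gen x -> (W *m rho x <= W)%MS.
    elim=> {x}[|||x y gx Hx gy Hy|c x y gx Hx gy Hy] //.
    + by rewrite rho1 mulmx1.
    + by rewrite rhoM // mulmxA; apply: submx_trans (submxMr _ Hx) Hy.
    by rewrite rhoP // mulmxDr -scalemxAr addmx_sub // scalemx_sub.
  have [i Wi] : exists i, row i W != 0.
    apply/existsP; apply: contraLR W0 => /existsPn H; rewrite -leqNgt leqn0 mxrank_eq0.
    by apply/eqP/row_matrixP => i; rewrite row0; apply/eqP/negPn/H.
  (* A nonzero class x has some g with chi (x g) nonzero; x g es0 and chi (x g) es0 have the same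
     class, so W contains the generator [pi es0]. *)
  have [x gx Ex] := pi_surj (row i W).
  have [g gg chig] : exists2 g, gen g & chi (x * g) != 0.
    apply: boolp.contrapT => H; case/eqP: Wi; rewrite Ex; apply/pi0 => // g gg.
    by apply/eqP/negPn/negP => Hg; apply: H; exists g.
  have es0W : (pi es0 <= W)%MS.
    rewrite -[pi es0]scale1r -(mulVf chig) -scalerA scalemx_sub //.
    rewrite -pi_mul_es0; last exact: genM.
    rewrite -mulrA piM //; last exact: genM.
    by rewrite -Ex; apply: submx_trans (submxMr _ (row_sub _ _)) (stab _ (genM gg g0)).
  suff /eqP : row_full W by [].
  rewrite -sub1mx; apply/rV_subP => v _.
  have [f gf ->] := pi_surj v; rewrite -pi_es0 // piM //.
  exact: submx_trans (submxMr _ es0W) (stab _ gf).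
- apply: contra_neq pi_es0_neq0 => r0; rewrite -pi_es0 // piM // r0 mulmx0 //.
- suff /mxrankS H : (rho es0 <= pi es0)%MS by apply: leq_trans H (rank_leq_row _).
  apply/row_subP => i; rewrite rowE.
  have [f gf ->] := pi_surj (delta_mx 0 i).
  by rewrite -piM // pi_mul_es0 // scalemx_sub.
move=> k; have [gx ->] : gen (tau_alg th k a) /\
    tau_alg th k (rho a) = rho (tau_alg th k a).
  rewrite /tau_alg; elim/big_rec2: _ => [|i x y _ [gy ->]].
    by split; [apply: gen1|rewrite rho1].
  have gf : gen (a - (th i)%:A).
    by rewrite addrC -scaleNr; apply: genP ga; apply: gen1.
  split; first exact: genM.
  rewrite rhoM // [a - _]addrC -!scaleNr rhoP ?rho1 //; last exact: gen1.
  by rewrite [X in X * _ = _]addrC.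
move: (tau_alg th k a) gx => x gx.
have gx0 := genM gx g0; have g0x := genM g0 gx; have g0x0 := genM g0x g0.
rewrite -!rhoM // -rhoZ //; apply: rho_ext => //; first exact: gZ.
move=> f gf; rewrite !mulrA pi_mul_es0; last exact: genM (genM gf g0) gx.
have gf0 := genM gf g0.
have pi00 : pi 0 = 0 by apply/pi0 => // g _; rewrite mul0r chi0.
have -> : pi (f * (chi x *: es0)) = chi x *: pi (f * es0).
  by rewrite -scalerAr -[chi x *: (f * es0)]addr0 piP // pi00 addr0.
by rewrite chiM // pi_mul_es0 // scalerA mulrC.
Qed.
End Existence.

(* E_0 and E_d are nonzero by (C2); they force every other idempotent to be
   nonzero, because a vanishing one would give [e 0 * es 0 * e d = 0]. *)
Lemma split_rel_idem_neq0 (F : fieldType) (d : nat) (th ths zeta : nat -> F)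
    (B : algType F) (a : B) (e : 'I_d.+1 -> B) (as_ : B) (es : 'I_d.+1 -> B) :
  T_relations th ths a e as_ es -> C1 d th ths -> C2 d th ths zeta ->
  split_rel th ths zeta a es -> es ord0 != 0 ->
  (forall i, e i != 0) /\ (forall i, es i != 0).
Proof.
move=> HT HC1 [_ zd sum_neq0] Hs es0_neq0; have HTd := T_relations_dual HT.
have [c1 c1_neq0 H1] := split_e_0 HT HC1 Hs.
have [c2 c2_neq0 H2] := split_e_max HT HC1 Hs.
(* es_0 e_0 es_0 e_d es_0 is es_0 times both scalars of (C2), up to nonzero factors. *)
have corner : e ord0 * es ord0 * e ord_max != 0.
  apply: contra_neq es0_neq0 => X0.
  have : es ord0 * e ord0 * es ord0 * (es ord0 * e ord_max * es ord0) = 0.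
    rewrite !mulrA -[_ * es ord0 * es ord0]mulrA (T_idemM HTd) eqxx.
    by rewrite -[_ * e ord0 * es ord0]mulrA -[es ord0 * _ * e ord_max]mulrA X0 mulr0 mul0r.
  rewrite H1 H2 -scalerAl -scalerAr scalerA (T_idemM HTd) eqxx => /eqP.
  rewrite scaler_eq0 !mulf_eq0 (negPf c1_neq0) (negPf c2_neq0) /=.
  by rewrite (introF eqP zd) (introF eqP sum_neq0) => /eqP.
have HC1d : C1 d ths th by case: HC1.
(* Apply [es_neq0] with the roles of a and as_ exchanged: es_0 is a polynomial in as_ of degree at
   most d, so e_0 as_^d e_d is nonzero. *)
split; first exact: (es_neq0 HTd (corner_pow HTd HC1d corner)).
move=> i; have [-> //|i0] := eqVneq i ord0.
apply: contra_neq corner => esi0; pose I := [pred j : 'I_d.+1 | j != i].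
have I0 : I ord0 by rewrite /I /= eq_sym.
pose w := node_poly ths I ord0.
have w0 : w.[ths (ord0 : 'I_d.+1)] != 0 by rewrite (horner_node_poly HC1.2).
have as_w : horner_alg as_ w = w.[ths (ord0 : 'I_d.+1)] *: es ord0.
  rewrite (horner_algE (T_idemM HTd) (T_idem1 HTd) (T_aE HTd)) (bigD1 ord0) //=.
  rewrite big1 ?addr0 // => j j0; have [->|ji] := eqVneq j i; first by rewrite esi0 scaler0.
  have := horner_node_poly HC1.2 ord0 (ji : I j).
  by rewrite (negPf j0) => /negbFE/eqP; rewrite -/w => ->; rewrite scale0r.
have := T_band HT (i := ord0) (j := ord_max) (w := w).
rewrite as_w size_node_poly // -scalerAr -scalerAl /= => /(_ _)/eqP.
rewrite scaler_eq0 (negPf w0) /= => H; apply/eqP/H.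
suff -> : #|I| = d by rewrite max0n min0n subn0.
have := cardC (pred1 i); rewrite card1 card_ord add1n => -[E].
exact: etrans (eq_card _) E.
Qed.

Lemma TD_exists (F : fieldType) (d : nat) (th ths zeta : nat -> F) :
  mu_injective d th ths -> C1 d th ths -> C2 d th ths zeta ->
  exists (n : nat) (A As : 'M[F]_n.+1) (E Es : 'I_d.+1 -> 'M[F]_n.+1),
    sharp_TD_system_param A E As Es th ths zeta.
Proof.
move=> Hmu HC1 HC2; have [B [a [e [as_ [es [HT mu_inj]]]]]] := mu_faithful Hmu.
pose z k := zeta k / \prod_(1 <= j < k.+1) (ths 0%N - ths j).
have z0 : z 0%N = 1 by rewrite /z big_geq // divr1; case: HC2.
have [chi [chiP chiM chi_es0 chi1 chi_tau]] := character_exists HT HC1 mu_inj z0.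
have [n [rho [HTr irr es0_neq0 rk_es0 Hrho]]] :=
  character_module HT HC1 chiP chiM chi_es0 chi1.
exists n, (rho a), (rho as_), (fun i => rho (e i)), (fun i => rho (es i)).
have Hs : split_rel th ths zeta (rho a) (fun i => rho (es i)).
  by move=> i; rewrite Hrho chi_tau // -ltnS.
have [e_neq0 es_neq0] := split_rel_idem_neq0 HTr HC1 HC2 Hs es0_neq0.
have D : TD_data th ths (rho a) (rho as_) (fun i => rho (e i)) (fun i => rho (es i)).
  by split.
have [sys Eth Ests] := TD_data_system D; split=> //.
  apply/eqP; rewrite eqn_leq lt0n mxrank_eq0 e_neq0 andbT.
  exact: leq_trans (rank_E0_le HTr irr (e_neq0 _)) rk_es0.
move=> i; rewrite -Hs /tau_alg; congr (_ *m _ *m _); apply: eq_bigr => j _.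
by rewrite scalemx1.
Qed.

Theorem theorem10p1 (F : fieldType) (Hmu : mu_conjecture F)
  (d : nat) (th ths zeta : nat -> F) :
  ((exists (n : nat) (A As : 'M[F]_n.+1) (E Es : 'I_d.+1 -> 'M[F]_n.+1),
       sharp_TD_system_param A E As Es th ths zeta)
    <-> [/\ C1 d th ths, C2 d th ths zeta & C3 d th ths]) /\
  ([/\ C1 d th ths, C2 d th ths zeta & C3 d th ths] ->
   forall (n m : nat) (A As : 'M[F]_n.+1) (E Es : 'I_d.+1 -> 'M[F]_n.+1)
          (A' As' : 'M[F]_m.+1) (E' Es' : 'I_d.+1 -> 'M[F]_m.+1),
     sharp_TD_system_param A E As Es th ths zeta ->
     sharp_TD_system_param A' E' As' Es' th ths zeta ->
     TD_iso A E As Es A' E' As' Es').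
Proof.
split=> [|_ n m A As E Es A' As' E' Es']; last exact: TD_unique.
split=> [[n [A [As [E [Es]]]]]|[HC1 HC2 HC3]]; first exact: TD_necessary.
exact: TD_exists (Hmu d th ths HC1 HC3) HC1 HC2.
Qed.
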